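(* Let $k$ be a field. Every affine-triangular automorphism $f\in \mathrm{Aut}(\mathbb{A}^3)$ of $\mathbb{A}^3=\mathbb{A}^3_k$ is conjugate (in $\mathrm{Aut}(\mathbb{A}^3)$) to a permutation-triangular automorphism $f'\in \mathrm{Aut}(\mathbb{A}^3)$ such that $\deg(f')\le \deg(f)$ and such that $f'$ has the following property: either the maximal eigenvalue $\theta$ of $f'$ is equal to $1$, or $f'$ is $\mu$-algebraically stable for each maximal eigenvector $\mu$ of $f'$. In particular, the dynamical degrees $\lambda(f)$ and $\lambda(f')$ are equal to the maximal eigenvalue $\theta$ of $f'$, which is a Handelman number.
   Context: An endomorphism of $\mathbb{A}^n=\mathbb{A}^n_k$ is a tuple $f=(f_1,\ldots,f_n)\in k[x_1,\ldots,x_n]^n$, with composition $(f\circ g)_i=f_i(g_1,\ldots,g_n)$; $f^r$ is the $r$-fold iterate; $\mathrm{Aut}(\mathbb{A}^n)$ is the group of invertible endomorphisms. $\deg(f)=\max_i \deg(f_i)$, and for dominant $f$ the dynamical degree is $\lambda(f)=\lim_{r\to\infty}\deg(f^r)^{1/r}$ (the limit exists). An affine automorphism is an automorphism of degree $1$; $\tau$ is triangular if $\tau_i\in k[x_1,\ldots,x_i]$ for each $i$; $\alpha$ is a permutation of the coordinates if $\{\alpha_1,\ldots,\alpha_n\}=\{x_1,\ldots,x_n\}$. An endomorphism is affine-triangular (respectively permutation-triangular) if it equals $\alpha\circ\tau$ with $\tau$ a triangular endomorphism and $\alpha$ an affine automorphism (respectively a permutation of the coordinates). A Handelman number is a positive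 real number that is a root of a monic polynomial with integer coefficients all of whose coefficients except the leading one are non-positive. For $\mu=(\mu_1,\ldots,\mu_n)\in(\mathbb{R}_{\ge0})^n\setminus\{0\}$, $\deg_\mu$ on $k[x_1,\ldots,x_n]$ is given by $\deg_\mu(0)=-\infty$ and, for $p\ne0$, $\deg_\mu(p)=\max\{\sum_i a_i\mu_i\}$ over all exponents $(a_1,\ldots,a_n)$ of monomials appearing in $p$ with nonzero coefficient. For a nonzero $f\in\mathrm{End}(\mathbb{A}^n)$, $\deg_\mu(f)=\inf\{\theta\in\mathbb{R}_{\ge0}\mid \deg_\mu(f_i)\le\theta\mu_i\text{ for all }i\}$, with $\deg_\mu(f)=\infty$ if this set is empty. $f$ is $\mu$-algebraically stable if $\deg_\mu(f)<\infty$ and $\deg_\mu(f^r)=\deg_\mu(f)^r$ for each $r\ge1$. Let $f\in\mathrm{End}(\mathbb{A}^n)$ with all $f_i\ne0$. A matrix $M=(m_{i,j})\in\mathrm{Mat}_n(\mathbb{N})$ (with $0\in\mathbb{N}$) is contained in $f$ if for each $i$ the coefficient of $\prod_{j=1}^n x_j^{m_{i,j}}$ in $f_i$ is nonzero. The maximal eigenvalue of $f$ is $\theta=\max\{|\xi| \mid \xi\text{ is a (complex) eigenvalue of a matrix contained in } f\}$. A maximal eigenvector of $f$ is an element $\mu\in(\mathbb{R}_{\ge0})^n\setminus\{0\}$ with $\deg_\mu(f_i)=\theta\mu_i$ for each $i$. *)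

(* Defs.v *)
(* mpoly has to be imported before all_analysis: in the opposite order the
   notations of the two libraries clash. *)
From HB Require Import structures.
From mathcomp Require Import all_boot all_order all_algebra.
From mathcomp Require Import mpoly complex.
From mathcomp Require Import all_classical all_reals all_analysis.

Set Implicit Arguments.
Unset Strict Implicit.
Unset Printing Implicit Defensive.

Import Order.TTheory GRing.Theory Num.Theory.
Import numFieldNormedType.Exports.

Local Open Scope classical_set_scope.
Local Open Scope ring_scope.

Section Endomorphisms.
Variables (k : fieldType) (n : nat).

Definition endo := n.-tuple {mpoly k[n]}.

Definition endo_id : endo := [tuple 'X_i | i < n].

Definition endo_comp (f g : endo) : endo := [tuple tnth f i \mPo g | i < n].

Definition endo_iter (f : endo) (r : nat) : endo := iter r (endo_comp f) endo_id.

Definition endo_inverse (f g : endo) : Prop :=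
  endo_comp f g = endo_id /\ endo_comp g f = endo_id.

Definition is_aut (f : endo) : Prop := exists g : endo, endo_inverse f g.

(* msize p is deg p + 1 when p != 0; zero components contribute 0. *)
Definition endo_deg (f : endo) : nat := \max_(i < n) (msize (tnth f i)).-1.

Definition is_affine_aut (f : endo) : Prop := is_aut f /\ endo_deg f = 1%N.

(* With indices starting from 0, the i-th component only involves the
   variables 'X_j with j <= i. *)
Definition is_triangular (f : endo) : Prop :=
  forall (i : 'I_n) (m : 'X_{1..n}), m \in msupp (tnth f i) ->
  forall j : 'I_n, (i < j)%N -> m j = 0%N.

(* Equality of sets {f_1, .., f_n} = {x_1, .., x_n}; as the x_i are n distinct
   elements, f is then a permutation of them. *)
Definition is_coord_perm (f : endo) : Prop := f =i endo_id.

Definition affine_triangular (f : endo) : Prop :=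
  exists a t : endo,
    [/\ is_affine_aut a, is_triangular t & f = endo_comp a t].

Definition permutation_triangular (f : endo) : Prop :=
  exists a t : endo,
    [/\ is_coord_perm a, is_triangular t & f = endo_comp a t].

Definition aut_conjugate (f f' : endo) : Prop :=
  exists phi psi : endo,
    endo_inverse phi psi /\ f' = endo_comp psi (endo_comp f phi).

Definition contained_in (M : 'M[nat]_n) (f : endo) : Prop :=
  forall i : 'I_n, (tnth f i)@_[multinom M i j | j < n] != 0.

End Endomorphisms.

Section RealInvariants.
Variables (R : realType) (k : fieldType) (n : nat).
Implicit Types (f : endo k n) (mu : 'rV[R]_n).

(* l is the limit of deg(f^r)^(1/r), convergence included. *)
Definition is_dynamical_degree f (l : R) : Prop :=
  (fun r : nat => ((endo_deg (endo_iter f r))%:R : R) `^ (r%:R)^-1) @ \oo --> l.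

Definition is_weight mu : Prop := (forall i, 0 <= mu 0 i) /\ mu != 0.

(* The empty maximum is -oo, so that pdeg_mu mu 0 = -oo. *)
Definition pdeg_mu mu (p : {mpoly k[n]}) : \bar R :=
  \big[maxe/-oo%E]_(m <- msupp p) (\sum_(i < n) (m i)%:R * mu 0 i)%:E.

(* The infimum of the empty set is +oo. *)
Definition deg_mu mu f : \bar R :=
  ereal_inf [set theta%:E | theta in [set theta : R |
    0 <= theta /\
    forall i : 'I_n, (pdeg_mu mu (tnth f i) <= (theta * mu 0 i)%:E)%E]].

Definition algebraically_stable mu f : Prop :=
  (deg_mu mu f < +oo)%E /\
  forall r : nat, (1 <= r)%N ->
    deg_mu mu (endo_iter f r) = (deg_mu mu f ^+ r)%E.

Definition eigenvalue_moduli f : set R :=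
  [set t | exists (M : 'M[nat]_n) (xi : R[i]),
    [/\ contained_in M f,
        eigenvalue (map_mx (fun a : nat => a%:R : R[i]) M) xi &
        ComplexField.Normc.normc xi = t]].

Definition is_maximal_eigenvalue f (theta : R) : Prop :=
  eigenvalue_moduli f theta /\ ubound (eigenvalue_moduli f) theta.

(* Meant for theta the maximal eigenvalue of f. *)
Definition is_maximal_eigenvector f (theta : R) mu : Prop :=
  is_weight mu /\
  forall i : 'I_n, pdeg_mu mu (tnth f i) = (theta * mu 0 i)%:E.

End RealInvariants.

Definition is_handelman (R : realType) (x : R) : Prop :=
  0 < x /\
  exists p : {poly int},
    [/\ p \is monic, (forall i : nat, (i < (size p).-1)%N -> p`_i <= 0) &
        root (map_poly intr p) x].

(* Main.v *)
(* By the Bruhat decomposition of the linear part of its affine factor, [f] is conjugate,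
   without increasing the degree, to a permutation-triangular automorphism, whose
   components are, up to order, [a x + e], [b y + p(x)] and [c z + q(x, y)]. For each of
   the six orders one solves for the maximal eigenvalue [th], which is a root of a
   quadratic polynomial [X^2 - a X - b] with natural [a] and [b], and for the maximal
   eigenvectors [mu]. The top-weight part [g] of [f] is multiplicative under composition,
   so [f] is [mu]-algebraically stable as soon as the iterates of [g] do not vanish. This
   holds because [g] restricts to a monomial map on a coordinate subspace or to a dominant
   map of a coordinate plane, except possibly when the components of [f] are
   [b y + p(x)], [c z + q(x, y)], [a x + e] in this order, or the inverse 3-cycle: then
   an elementary conjugation that does not raise the degree removes [p]. Weights close to
   maximal eigenvectors bound the degrees of the iterates from above. *)

Require Import Defs.
From HB Require Import structures.
From mathcomp Require Import all_boot all_order all_algebra.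
From mathcomp Require Import mpoly complex.
From mathcomp Require Import all_classical all_reals all_analysis.
From mathcomp Require Import ring lra zify.

Set Implicit Arguments.
Unset Strict Implicit.
Unset Printing Implicit Defensive.

Import Order.TTheory GRing.Theory Num.Theory.
Import numFieldNormedType.Exports.

Local Open Scope ring_scope.

(** * Composition of endomorphisms *)

(** Iterates of [f] never exceed the weights [th ^+ r * mu i], so stability amounts to attaining
    them, and cancellation between top parts is the only obstacle. If the top parts of f_x, f_y, f_z
    are L, c L^d, x with L = b y + p x^d, the x-component of the second iterate of the top part is
    (b c + p) L^d, which may be zero. Survival is certified by evaluation: the top part of the
    iterate, evaluated at a point over a suitable k-algebra, is the r-th point of the orbit under
    the top part of [f]. A maximal eigenvector may have zero entries (x has weight 0 when f_x = a x
    + e and th > 1), and then it bounds neither degrees nor eigenvalues from above. Positive weights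
    for each eta > th bound both. At th = 1 top parts may be lost, and the lower bound is merely
    that automorphisms have degree at least 1. Conjugation changes the degrees of the iterates by a
    bounded factor, which the r-th root forgets. The quadratic equation of th expresses that some
    monomial reaches the weight allowed to its component. *)

Section MmapComp.
Variables (k : fieldType) (n n' : nat).

Lemma mmap_comp (S : comNzRingType) (h : {rmorphism k -> S}) (v : 'I_n' -> S)
    (p : {mpoly k[n]}) (g : n.-tuple {mpoly k[n']}) :
  mmap h v (p \mPo g) = mmap h (fun i => mmap h v (tnth g i)) p.
Proof.
rewrite comp_mpolyEX [in RHS](mpolyE p) !raddf_sum /=; apply: eq_bigr => m _.
rewrite !mmapZ; congr (_ * _).
rewrite comp_mpolyX rmorph_prod mmapX /mmap1 /=.
by apply: eq_bigr => i _; rewrite rmorphXn.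
Qed.

Lemma eq_mmap (S : comNzRingType) (h : {rmorphism k -> S}) (v w : 'I_n -> S)
    (p : {mpoly k[n]}) :
  (forall m i, m \in msupp p -> m i != 0%N -> v i = w i) ->
  mmap h v p = mmap h w p.
Proof.
move=> vw; rewrite /mmap big_seq [RHS]big_seq; apply: eq_bigr => m mp.
congr (_ * _); apply: eq_bigr => i _.
by have [->|mi0] := eqVneq (m i) 0%N; rewrite ?expr0 // (vw m).
Qed.

Lemma mmap_rmorph (S S' : comNzRingType) (h : {rmorphism k -> S}) (h' : {rmorphism k -> S'})
    (g : {rmorphism S -> S'}) (v : 'I_n -> S) (q : {mpoly k[n]}) :
  (forall c, g (h c) = h' c) -> g (mmap h v q) = mmap h' (fun i => g (v i)) q.
Proof.
move=> gh; rewrite rmorph_sum; apply: eq_bigr => m _; rewrite rmorphM /= gh; congr (_ * _).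
by rewrite rmorph_prod; apply: eq_bigr => i _; rewrite rmorphXn.
Qed.

End MmapComp.

Lemma iter_conj (T : Type) (op : T -> T -> T) (e f g h : T) :
  associative op -> left_id e op -> right_id e op -> op g h = e -> op h g = e ->
  forall r, iter r (op (op h (op f g))) e = op h (op (iter r (op f) e) g).
Proof.
move=> opA ope oep gh hg; elim=> [|r IH]; first by rewrite /= ope hg.
rewrite /= IH !opA; congr (op _ _); rewrite -!opA; congr (op _ (op _ _)).
by rewrite opA gh ope.
Qed.

Section EndoMonoid.
Variables (k : fieldType) (n : nat).
Implicit Types (f g h : endo k n) (p : {mpoly k[n]}).

Lemma tnth_endo_comp f g i : tnth (endo_comp f g) i = tnth f i \mPo g.
Proof. by rewrite tnth_mktuple. Qed.

Lemma tnth_endo_id i : tnth (endo_id k n) i = 'X_i.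
Proof. by rewrite tnth_mktuple. Qed.

Lemma comp_mpolyA p f g : (p \mPo f) \mPo g = p \mPo (endo_comp f g).
Proof.
rewrite {1}/comp_mpoly mmap_comp; apply: eq_mmap => m i _ _.
by rewrite tnth_endo_comp.
Qed.

Lemma comp_mpolyXE i f : 'X_i \mPo f = tnth f i.
Proof. by rewrite comp_mpolyXU -tnth_nth. Qed.

Lemma endo_compA f g h : endo_comp f (endo_comp g h) = endo_comp (endo_comp f g) h.
Proof.
by apply: eq_from_tnth => i; rewrite !tnth_endo_comp comp_mpolyA.
Qed.

Lemma endo_comp1 f : endo_comp f (endo_id k n) = f.
Proof. by apply: eq_from_tnth => i; rewrite tnth_endo_comp comp_mpoly_id. Qed.

Lemma endo_1comp f : endo_comp (endo_id k n) f = f.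
Proof.
by apply: eq_from_tnth => i; rewrite tnth_endo_comp tnth_endo_id comp_mpolyXE.
Qed.

Lemma endo_inverse_sym f g : endo_inverse f g -> endo_inverse g f.
Proof. by case. Qed.

Lemma endo_inverse_comp f f' g g' : endo_inverse f f' -> endo_inverse g g' ->
  endo_inverse (endo_comp f g) (endo_comp g' f').
Proof.
move=> [ff' f'f] [gg' g'g]; split.
- by rewrite -endo_compA (endo_compA g) gg' endo_1comp.
- by rewrite -endo_compA (endo_compA f') f'f endo_1comp.
Qed.

Lemma is_aut_comp f g : is_aut f -> is_aut g -> is_aut (endo_comp f g).
Proof.
move=> [f' ff'] [g' gg']; exists (endo_comp g' f').
exact: endo_inverse_comp.
Qed.

Lemma aut_conjugate_refl f : aut_conjugate f f.
Proof.
exists (endo_id k n), (endo_id k n); split; last by rewrite endo_comp1 endo_1comp.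
by split; rewrite endo_comp1.
Qed.

Lemma aut_conjugate_trans f g h :
  aut_conjugate f g -> aut_conjugate g h -> aut_conjugate f h.
Proof.
move=> [p [q [pq ->]]] [p' [q' [pq' ->]]].
exists (endo_comp p p'), (endo_comp q' q); split.
  exact: endo_inverse_comp.
by rewrite -(endo_compA q' q) -(endo_compA q) -(endo_compA f).
Qed.

Lemma aut_conjugate_sym f g : aut_conjugate f g -> aut_conjugate g f.
Proof.
move=> [p [q [[pq qp] ->]]]; exists q, p; split=> //.
by rewrite !endo_compA pq endo_1comp -endo_compA pq endo_comp1.
Qed.

Lemma aut_conjugate_aut f g : aut_conjugate f g -> is_aut f -> is_aut g.
Proof.
move=> [p [q [pq ->]]] f_aut; apply: is_aut_comp; first by exists p; apply: endo_inverse_sym.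
by apply: is_aut_comp => //; exists q.
Qed.

Lemma endo_iterS f r : endo_iter f r.+1 = endo_comp f (endo_iter f r).
Proof. by []. Qed.

Lemma endo_iter_conj f g h r : endo_inverse g h ->
  endo_iter (endo_comp h (endo_comp f g)) r = endo_comp h (endo_comp (endo_iter f r) g).
Proof.
move=> [gh hg]; apply: iter_conj => //; [exact: endo_compA|exact: endo_1comp|exact: endo_comp1].
Qed.

End EndoMonoid.

(** * Real weights and top parts *)

Section Weights.
Variables (R : realFieldType) (k : fieldType) (n : nat).
Implicit Types (mu nu : 'I_n -> R) (p q : {mpoly k[n]}) (m : 'X_{1..n}).

Definition wt mu m : R := \sum_(i < n) (m i)%:R * mu i.

(** This is [deg_mu p <= D] without extended reals, vacuous for [p = 0]. [R] is any real field
    because rational weights also serve: constant 1 for the ordinary degree, indicators for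
    [below]. *)
Definition wle mu (D : R) p := forall m, m \in msupp p -> wt mu m <= D.

Lemma wt0 mu : wt mu 0%MM = 0.
Proof. by rewrite /wt big1 // => i _; rewrite mnm0E mul0r. Qed.

Lemma wtD mu m m' : wt mu (m + m')%MM = wt mu m + wt mu m'.
Proof. by rewrite -big_split; apply: eq_bigr => i _; rewrite mnmDE natrD mulrDl. Qed.

Lemma wtU mu i : wt mu U_(i)%MM = mu i.
Proof.
rewrite /wt (bigD1 i) //= mnm1E eqxx mul1r big1 ?addr0 // => j ji.
by rewrite mnm1E eq_sym (negbTE ji) mul0r.
Qed.

Lemma wtZ mu c m : wt (fun i => c * mu i) m = c * wt mu m.
Proof. by rewrite mulr_sumr; apply: eq_bigr => i _; rewrite mulrCA. Qed.

Lemma wt_ge0 mu m : (forall i, 0 <= mu i) -> 0 <= wt mu m.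
Proof. by move=> mu0; apply: sumr_ge0 => i _; rewrite mulr_ge0. Qed.

Lemma wt_le mu nu m : (forall i, mu i <= nu i) -> wt mu m <= wt nu m.
Proof. by move=> e; apply: ler_sum => i _; rewrite ler_wpM2l. Qed.

Lemma wt_const c m : wt (fun=> c) m = (mdeg m)%:R * c.
Proof. by rewrite mdegE natr_sum mulr_suml. Qed.

Lemma wle_trans mu D E p : D <= E -> wle mu D p -> wle mu E p.
Proof. by move=> DE pD m /pD /le_trans; apply. Qed.

Lemma wle0 mu D : wle mu D 0.
Proof. by move=> m; rewrite msupp0. Qed.

Lemma wleD mu D p q : wle mu D p -> wle mu D q -> wle mu D (p + q).
Proof.
by move=> pD qD m /msuppD_le; rewrite mem_cat => /orP[/pD|/qD].
Qed.

Lemma wleZ mu D c p : wle mu D p -> wle mu D (c *: p).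
Proof. by move=> pD m /msuppZ_le /pD. Qed.

Lemma wleB mu D p q : wle mu D p -> wle mu D q -> wle mu D (p - q).
Proof. by move=> pD qD; rewrite -scaleN1r; apply: wleD => //; apply: wleZ. Qed.

Lemma wle_sum mu D (I : Type) (r : seq I) (P : pred I) (F : I -> {mpoly k[n]}) :
  (forall i, P i -> wle mu D (F i)) -> wle mu D (\sum_(i <- r | P i) F i).
Proof.
by move=> FD; elim/big_rec: _ => [|i q Pi qD]; [apply: wle0|apply: wleD => //; apply: FD].
Qed.

Lemma wleM mu D E p q : wle mu D p -> wle mu E q -> wle mu (D + E) (p * q).
Proof.
move=> pD qE m /msuppM_le /allpairsP [[m1 m2] /= [m1p m2q ->]].
by rewrite wtD lerD ?pD ?qE.
Qed.

Lemma wleX mu m : wle mu (wt mu m) 'X_[m].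
Proof. by move=> m'; rewrite msuppX inE => /eqP ->. Qed.

Lemma wle_XU mu i : wle mu (mu i) 'X_i.
Proof. by rewrite -[in X in wle _ X](wtU mu i); apply: wleX. Qed.

Lemma wleC mu D c : 0 <= D -> wle mu D c%:MP.
Proof.
by move=> D0 m; rewrite msuppC; case: eqP => //; rewrite inE => _ /eqP ->; rewrite wt0.
Qed.

Lemma wleXn mu D p e : wle mu D p -> wle mu (e%:R * D) (p ^+ e).
Proof.
move=> pD; elim: e => [|e IH]; first by rewrite mul0r expr0; apply: wleC.
by rewrite exprS mulrSr mulrDl mul1r addrC; apply: wleM.
Qed.

Lemma wle_prod mu (D : 'I_n -> R) (F : 'I_n -> {mpoly k[n]}) :
  (forall i, wle mu (D i) (F i)) -> wle mu (\sum_i D i) (\prod_i F i).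
Proof.
move=> FD; elim/big_rec2: _ => [|i D' q _ IH]; first exact: wleC.
exact: wleM.
Qed.

Lemma wle_comp mu nu D p (g : endo k n) :
  wle nu D p ->
  (forall i m, m \in msupp p -> m i != 0%N -> wle mu (nu i) (tnth g i)) ->
  wle mu D (p \mPo g).
Proof.
move=> pD gD; rewrite comp_mpolyEX big_seq; apply: wle_sum => m mp; apply: wleZ.
rewrite comp_mpolyX; apply: wle_trans (pD _ mp) _.
apply: wle_prod => i; have [->|mi0] := eqVneq (m i) 0%N.
  by rewrite expr0 mul0r; apply: wleC.
by apply: wleXn; apply: gD mp mi0.
Qed.

(** The level [D] is a parameter rather than the actual degree of [p]. This makes [wtop] linear, and
    a zero value means that the level is not reached. *)
Definition wtop mu (D : R) p : {mpoly k[n]} :=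
  \sum_(m <- msupp p | wt mu m == D) p@_m *: 'X_[m].

Lemma mcoeff_wtop mu D p m : (wtop mu D p)@_m = p@_m *+ (wt mu m == D).
Proof.
rewrite raddf_sum /= big_mkcond /=.
have [mp|mp] := boolP (m \in msupp p); last first.
  rewrite (memN_msupp_eq0 mp) mul0rn big1_seq // => m' /andP[_ m'p].
  case: ifP => // _; rewrite mcoeffZ mcoeffX.
  by case: eqP m'p mp => [->|_ _ _]; [move=> ->|rewrite mulr0].
rewrite (bigD1_seq m) ?msupp_uniq //= big1 ?addr0 => [|m' m'm]; last first.
  by case: ifP => // _; rewrite mcoeffZ mcoeffX (negbTE m'm) mulr0.
by case: eqP => // _; rewrite mcoeffZ mcoeffX eqxx mulr1.
Qed.

Lemma msupp_wtop mu D p m : m \in msupp (wtop mu D p) = (m \in msupp p) && (wt mu m == D).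
Proof.
by rewrite !mcoeff_msupp mcoeff_wtop; case: (wt mu m == D); rewrite ?andbT ?andbF ?eqxx.
Qed.

Lemma wtop_is_linear mu D : linear (wtop mu D).
Proof.
move=> c p q; apply/mpolyP => m.
by rewrite mcoeffD mcoeffZ !mcoeff_wtop mcoeffD mcoeffZ mulrnDl mulrnAr.
Qed.

HB.instance Definition _ mu D :=
  GRing.isLinear.Build k {mpoly k[n]} {mpoly k[n]} _ (wtop mu D) (wtop_is_linear mu D).

Lemma wtopX mu D m : wtop mu D 'X_[m] = 'X_[m] *+ (wt mu m == D).
Proof.
rewrite /wtop msuppX big_mkcond big_seq1; case: eqP => // _.
by rewrite mcoeffX eqxx scale1r.
Qed.

Lemma wtop1 mu : wtop mu 0 1 = 1.
Proof. by rewrite -mpolyX0 wtopX wt0 eqxx. Qed.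

(** A product of monomials reaches weight [D + E] only if both factors reach their own bounds. *)
Lemma wtopM mu D E p q : wle mu D p -> wle mu E q ->
  wtop mu (D + E) (p * q) = wtop mu D p * wtop mu E q.
Proof.
move=> pD qE; rewrite {1}mpolyME big_allpairs linear_sum /= [in RHS]/wtop mulr_suml [RHS]big_mkcond /=.
rewrite big_seq [RHS]big_seq; apply: eq_bigr => m mp.
rewrite linear_sum /=; case: ifPn => [/eqP wm|wm].
  rewrite mulr_sumr [RHS]big_mkcond big_seq [RHS]big_seq; apply: eq_bigr => m' mq.
  rewrite linearZ /= wtopX wtD wm (inj_eq (addrI _)); case: ifP => _; last first.
    by rewrite mulr0n scaler0.
  by rewrite -scalerAl -scalerAr scalerA mulr1n mpolyXD.
rewrite big_seq big1 // => m' mq; rewrite linearZ /= wtopX wtD.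
have wlt : wt mu m < D by rewrite lt_neqAle wm pD.
by rewrite lt_eqF ?mulr0n ?scaler0 // ltr_leD // qE.
Qed.

Lemma wtopXn mu D p e : wle mu D p -> wtop mu (e%:R * D) (p ^+ e) = wtop mu D p ^+ e.
Proof.
move=> pD; elim: e => [|e IH]; first by rewrite mul0r !expr0 wtop1.
by rewrite !exprS mulrSr mulrDl mul1r addrC wtopM ?IH //; apply: wleXn.
Qed.

Lemma wtop_prod mu (D : 'I_n -> R) (F : 'I_n -> {mpoly k[n]}) :
  (forall i, wle mu (D i) (F i)) ->
  wtop mu (\sum_i D i) (\prod_i F i) = \prod_i wtop mu (D i) (F i).
Proof.
move=> FD; pose P (D : R) (p q : {mpoly k[n]}) := wle mu D p /\ wtop mu D p = q.
suff [] : P (\sum_i D i) (\prod_i F i) (\prod_i wtop mu (D i) (F i)) by [].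
apply: (big_rec3 P) => [|i q p D' _ [pD e]]; first by split; [exact: wleC|exact: wtop1].
by split; [exact: wleM|rewrite wtopM // e].
Qed.

Lemma wtop_lt mu D E p : wle mu D p -> D < E -> wtop mu E p = 0.
Proof.
move=> pD DE; rewrite /wtop big_seq_cond big1 // => m /andP[mp /eqP wm].
by have := pD _ mp; rewrite wm leNgt DE.
Qed.

(** Monomials of [p] lighter than [D] stay lighter after substitution, so only those of weight [D]
    contribute. *)
Lemma wtop_comp mu nu D p (g : endo k n) :
  wle nu D p -> (forall i, wle mu (nu i) (tnth g i)) ->
  wtop mu D (p \mPo g) =
  wtop nu D p \mPo [tuple wtop mu (nu i) (tnth g i) | i < n].
Proof.
move=> pD gD; rewrite comp_mpolyEX {2}/wtop !linear_sum /= big_mkcond [RHS]big_mkcond /=.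
rewrite big_seq [RHS]big_seq; apply: eq_bigr => m mp.
rewrite !linearZ /= !comp_mpolyX.
have gm i : wle mu ((m i)%:R * nu i) (tnth g i ^+ m i) by apply: wleXn.
case: eqP => [<-|/eqP wm].
  rewrite /wt wtop_prod //; congr (_ *: _); apply: eq_bigr => i _.
  by rewrite wtopXn // tnth_mktuple.
rewrite (@wtop_lt mu (wt nu m)) ?scaler0 //; first exact: wle_prod.
by rewrite lt_neqAle wm pD.
Qed.

Lemma mmap_wtop (S : comNzRingType) (h : {rmorphism k -> S}) (v : 'I_n -> S) mu D p :
  mmap h v (wtop mu D p) =
  \sum_(m <- msupp p | wt mu m == D) h p@_m * mmap1 v m.
Proof.
rewrite raddf_sum; apply: eq_bigr => m _.
by rewrite /= mmapZ mmapX.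
Qed.

Lemma wle_iter mu th (f : endo k n) : 0 <= th ->
  (forall i, wle mu (th * mu i) (tnth f i)) ->
  forall r i, wle mu (th ^+ r * mu i) (tnth (endo_iter f r) i).
Proof.
move=> th0 fth; elim=> [|r IH] i.
  by rewrite expr0 mul1r tnth_endo_id; apply: wle_XU.
rewrite endo_iterS tnth_endo_comp.
apply: (@wle_comp mu (fun j => th ^+ r * mu j)) => [m mf|j m _ _]; last exact: IH.
by rewrite wtZ exprSr -mulrA ler_wpM2l ?exprn_ge0 // fth.
Qed.

(** [V] is the orbit of the point [V 0] under the top part of [f]. Evaluating at a point replaces
    the composition of top parts, and the ring [S] can be chosen so that nonvanishing is visible. *)
Lemma wtop_iter mu th (f : endo k n) (S : comNzRingType) (h : {rmorphism k -> S})
    (V : nat -> 'I_n -> S) : 0 < th ->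
  (forall i, wle mu (th * mu i) (tnth f i)) ->
  (forall r i, V r.+1 i = mmap h (V r) (wtop mu (th * mu i) (tnth f i))) ->
  forall r i, mmap h (V 0%N) (wtop mu (th ^+ r * mu i) (tnth (endo_iter f r) i)) = V r i.
Proof.
move=> th0 fth VE; have iterf := wle_iter (ltW th0) fth.
elim=> [|r IH] i.
  by rewrite expr0 mul1r tnth_endo_id wtopX wtU eqxx mmapX mmap1U.
rewrite endo_iterS tnth_endo_comp.
(* Scaling all weights by [th ^+ r] does not change which monomials are on top. *)
have wE m : wt (fun j => th ^+ r * mu j) m == th ^+ r.+1 * mu i = (wt mu m == th * mu i).
  by rewrite wtZ exprSr -mulrA (inj_eq (mulfI _)) // expf_neq0 // gt_eqF.
rewrite (@wtop_comp mu (fun j => th ^+ r * mu j)) //; last first.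
  move=> m mf; rewrite wtZ exprSr -mulrA ler_pM2l ?exprn_gt0 //; exact: fth.
rewrite mmap_comp VE.
have -> : wtop (fun j => th ^+ r * mu j) (th ^+ r.+1 * mu i) (tnth f i) =
          wtop mu (th * mu i) (tnth f i).
  by apply/mpolyP => m; rewrite !mcoeff_wtop wE.
by apply: eq_mmap => m j _ _; rewrite tnth_mktuple IH.
Qed.

Lemma wtop_iter_neq0 mu th (f : endo k n) (S : comNzRingType) (h : {rmorphism k -> S})
    (V : nat -> 'I_n -> S) : 0 < th ->
  (forall i, wle mu (th * mu i) (tnth f i)) ->
  (forall r i, V r.+1 i = mmap h (V r) (wtop mu (th * mu i) (tnth f i))) ->
  forall r i, V r i != 0 ->
  exists2 m, m \in msupp (tnth (endo_iter f r) i) & wt mu m = th ^+ r * mu i.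
Proof.
move=> th0 fth VE r i; rewrite -(wtop_iter th0 fth VE r i) => V0.
have /eqP : msupp (wtop mu (th ^+ r * mu i) (tnth (endo_iter f r) i)) <> [::].
  by move/eqP; rewrite msupp_eq0 => /eqP e; rewrite e raddf0 eqxx in V0.
case E : msupp => [//|m s] _.
have : m \in msupp (wtop mu (th ^+ r * mu i) (tnth (endo_iter f r) i)).
  by rewrite E inE eqxx.
by rewrite msupp_wtop => /andP[mf /eqP wm]; exists m.
Qed.

End Weights.

(** * Degree growth and algebraic stability *)

Section Degree.
Variables (k : fieldType) (n : nat).
Implicit Types (f g : endo k n).

Lemma mdeg_le_endo_deg f i m : m \in msupp (tnth f i) -> (mdeg m <= endo_deg f)%N.
Proof.
move=> mf; apply: leq_trans (leq_bigmax i).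
by have := msize_mdeg_lt mf; case: (mmeasure mdeg (tnth f i)).
Qed.

Lemma endo_deg_le f d :
  (forall i m, m \in msupp (tnth f i) -> (mdeg m <= d)%N) -> (endo_deg f <= d)%N.
Proof.
move=> fd; apply/bigmax_leqP => i _.
have : (msize (tnth f i) <= d.+1)%N.
  rewrite msizeE big_seq; elim/big_ind: _ => // [x y xd yd|m mf]; last exact: fd mf.
  by rewrite geq_max xd.
by case: (mmeasure mdeg (tnth f i)).
Qed.

Lemma endo_deg_wle (R : realFieldType) f : forall i, wle (fun=> 1 : R) (endo_deg f)%:R (tnth f i).
Proof. by move=> i m mf; rewrite wt_const mulr1 ler_nat; apply: mdeg_le_endo_deg mf. Qed.

Lemma wle_endo_deg (R : realFieldType) f d :
  (forall i, wle (fun=> 1 : R) d%:R (tnth f i)) -> (endo_deg f <= d)%N.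
Proof.
move=> fd; apply: endo_deg_le => i m /fd.
by rewrite wt_const mulr1 ler_nat.
Qed.

Lemma endo_deg_comp f g : (endo_deg (endo_comp f g) <= endo_deg f * endo_deg g)%N.
Proof.
apply: (@wle_endo_deg rat) => i; rewrite tnth_endo_comp.
apply: (@wle_comp _ _ _ _ (fun=> (endo_deg g)%:R)) => [m mf|j m _ _].
  by rewrite wt_const natrM ler_wpM2r // ler_nat; apply: mdeg_le_endo_deg mf.
exact: endo_deg_wle.
Qed.

(** In degree 0, submultiplicativity would force the identity to have degree 0. This is the lower
    bound on growth used at th = 1. *)
Lemma endo_deg_aut_gt0 f : (0 < n)%N -> is_aut f -> (0 < endo_deg f)%N.
Proof.
move=> n0 [g [fg _]]; rewrite lt0n; apply/eqP => f0.
have := endo_deg_comp f g; rewrite f0 mul0n leqn0 fg => /eqP.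
have : U_(Ordinal n0)%MM \in msupp (tnth (endo_id k n) (Ordinal n0)).
  by rewrite tnth_endo_id msuppX inE.
by move=> /mdeg_le_endo_deg; rewrite mdeg1 => + e; rewrite e.
Qed.

Lemma endo_iter_aut f r : is_aut f -> is_aut (endo_iter f r).
Proof.
move=> f_aut; elim: r => [|r IH]; last exact: is_aut_comp.
by exists (endo_id k n); split; apply: endo_comp1.
Qed.

(** The conjugating maps cancel inside the iterate, so they cost one constant factor independent of
    [r]. *)
Lemma endo_deg_iter_conj f g : aut_conjugate f g ->
  exists2 C : nat, (0 < C)%N &
    forall r, (endo_deg (endo_iter g r) <= C * endo_deg (endo_iter f r))%N.
Proof.
move=> [p [q [pq ->]]]; exists (endo_deg q * endo_deg p).+1 => // r.
rewrite endo_iter_conj //; apply: leq_trans (endo_deg_comp _ _) _.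
apply: (@leq_trans (endo_deg q * (endo_deg (endo_iter f r) * endo_deg p))).
  by rewrite leq_mul2l endo_deg_comp orbT.
by nia.
Qed.

End Degree.

Section Stability.
Variables (R : realType) (k : fieldType) (n : nat).
Implicit Types (f : endo k n) (mu : 'rV[R]_n).

Lemma pdeg_mu_le mu (p : {mpoly k[n]}) x :
  (pdeg_mu mu p <= x%:E)%E <-> wle (mu 0) x p.
Proof.
rewrite /pdeg_mu /wle; elim: (msupp p) => [|m s IH].
  by rewrite big_nil; split=> // _; apply: leNye.
rewrite big_cons ge_max; split.
  by move=> /andP[mx /IH sx] m'; rewrite inE => /predU1P[->|/sx//]; rewrite -lee_fin.
move=> sx; apply/andP; split; first by rewrite lee_fin; apply: sx; rewrite inE eqxx.
by apply/IH => m' m's; apply: sx; rewrite inE m's orbT.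
Qed.

Lemma pdeg_mu_attained mu (p : {mpoly k[n]}) x :
  pdeg_mu mu p = x%:E -> exists2 m, m \in msupp p & wt (mu 0) m = x.
Proof.
rewrite /pdeg_mu; elim: (msupp p) => [|m s IH]; first by rewrite big_nil.
rewrite big_cons /maxe; case: ifP => _.
  by move=> /IH [m' m's wm']; exists m'; rewrite // inE m's orbT.
by move=> [wm]; exists m; rewrite // inE eqxx.
Qed.

Definition weight_eigen f (th : R) (mu : 'I_n -> R) : Prop :=
  [/\ forall i, 0 <= mu i,
      forall i, wle mu (th * mu i) (tnth f i) &
      forall i, exists2 m, m \in msupp (tnth f i) & wt mu m = th * mu i].

Lemma maximal_eigenvector_weight f th mu : is_maximal_eigenvector f th mu ->
  weight_eigen f th (mu 0) /\ exists i, mu 0 i != 0.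
Proof.
move=> [[mu0 mun0] e]; split; last first.
  by have /rV0Pn := mun0.
split=> // i; first by apply/pdeg_mu_le; rewrite e.
exact: pdeg_mu_attained.
Qed.

(* For [mu] as in [weight_eigen], [th ^+ r * mu i] bounds the weights of the monomials
   of the [i]-th component of the [r]-th iterate. *)
Definition top_survives f (th : R) (mu : 'I_n -> R) : Prop :=
  forall r, exists i, 0 < mu i /\
    exists2 m, m \in msupp (tnth (endo_iter f r) i) & wt mu m = th ^+ r * mu i.

(** An index with [mu 0 i = 0] gives no lower bound on the admissible factors, so the bound has to
    be attained at a positive weight. This is why [top_survives] asks for [0 < mu i]. *)
Lemma deg_mu_eq f mu t : (forall i, 0 <= mu 0 i) -> 0 <= t ->
  (forall i, wle (mu 0) (t * mu 0 i) (tnth f i)) ->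
  (exists i, 0 < mu 0 i /\
    exists2 m, m \in msupp (tnth f i) & wt (mu 0) m = t * mu 0 i) ->
  deg_mu mu f = t%:E.
Proof.
move=> mu0 t0 ft [i [mui [m mf wm]]]; apply/eqP; rewrite eq_le; apply/andP; split.
  apply: ereal_inf_lbound; exists t => //; split=> // j.
  exact/pdeg_mu_le.
apply: le_ereal_inf_tmp => _ [t' [t'0 ft'] <-]; rewrite lee_fin.
have /pdeg_mu_le/(_ _ mf) := ft' i.
by rewrite wm ler_pM2r.
Qed.

Lemma top_survives_stable f th mu : (forall i, 0 <= mu 0 i) -> 0 <= th ->
  (forall i, wle (mu 0) (th * mu 0 i) (tnth f i)) ->
  top_survives f th (mu 0) -> algebraically_stable mu f.
Proof.
move=> mu0 th0 fth top.
have iterE r : deg_mu mu (endo_iter f r) = (th ^+ r)%:E.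
  by apply: deg_mu_eq => //; [exact: exprn_ge0|exact: wle_iter].
have fE : deg_mu mu f = th%:E.
  by have := iterE 1%N; rewrite endo_iterS endo_comp1 expr1.
by split=> [|r _]; rewrite ?iterE fE ?ltry // EFin_expe.
Qed.

Lemma top_survives_growth f th (mu : 'I_n -> R) : (forall i, 0 <= mu i) -> 0 <= th ->
  top_survives f th mu ->
  exists2 c : R, 0 < c & forall r, c * th ^+ r <= (endo_deg (endo_iter f r))%:R.
Proof.
move=> mu0 th0 top; pose M := \sum_i mu i.
have leM i : mu i <= M by rewrite /M (bigD1 i) //= lerDl sumr_ge0.
have [i0 [mui0 _]] := top 0%N.
have M0 : 0 < M by apply: lt_le_trans (leM i0).
(* [a] is the least positive weight; the default [M] is positive and at least every weight. *)
pose a := \big[Order.min/M]_(i | 0 < mu i) mu i.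
have a0 : 0 < a by apply/bigmin_gtP.
exists (a / M); first exact: divr_gt0.
move=> r; have [i [mui [m mf wm]]] := top r.
rewrite mulrAC ler_pdivrMr //.
apply: (@le_trans _ _ (wt mu m)).
  by rewrite wm mulrC ler_wpM2l ?exprn_ge0 // /a bigmin_le_cond.
apply: (@le_trans _ _ (wt (fun=> M) m)); first exact: wt_le.
by rewrite wt_const ler_wpM2r ?(ltW M0) // ler_nat; apply: mdeg_le_endo_deg mf.
Qed.

Lemma weight_bound_growth f eta (mu : 'I_n -> R) : (forall i, 0 < mu i) -> 0 <= eta ->
  (forall i, wle mu (eta * mu i) (tnth f i)) ->
  exists2 C : R, 0 < C & forall r, (endo_deg (endo_iter f r))%:R <= C * eta ^+ r.
Proof.
(* The summand 1 keeps [M] positive when there are no variables. *)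
move=> mu0 eta0 feta; pose M := 1 + \sum_i mu i.
have leM i : mu i <= M.
  by rewrite /M (bigD1 i) //= addrCA lerDl addr_ge0 // sumr_ge0 // => j _; apply: ltW.
have M0 : 0 < M by rewrite ltr_pwDl // sumr_ge0 // => i _; apply: ltW.
pose a := \big[Order.min/M]_i mu i.
have a0 : 0 < a by apply/bigmin_gtP.
exists (M / a) => [|r]; first exact: divr_gt0.
have C0 : 0 <= M / a * eta ^+ r by rewrite mulr_ge0 ?exprn_ge0 // ltW // divr_gt0.
(* A degree is an integer, so the real bound may be truncated before passing to single monomials. *)
apply: (@le_trans _ _ (Num.trunc (M / a * eta ^+ r))%:R); last by rewrite -truncn_ge_nat.
rewrite ler_nat; apply: endo_deg_le => i m mf; rewrite truncn_ge_nat //.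
rewrite mulrAC ler_pdivlMr //.
apply: (@le_trans _ _ (wt mu m)).
  by rewrite -wt_const; apply: wt_le => j; apply: bigmin_le.
apply: le_trans (wle_iter eta0 feta mf) _.
by rewrite mulrC ler_wpM2r ?exprn_ge0.
Qed.

End Stability.

(** * Eigenvalues of the contained matrices *)

Section Eigenvalues.
Variables (R : realType) (k : fieldType) (n : nat).
Implicit Types (f : endo k n).

(** A Collatz-Wielandt estimate: for a row eigenvector [v], pairing [|v|] with the positive vector
    [mu] gives [|xi| <|v|, mu> <= <|v|, M mu> <= eta <|v|, mu>]. *)
Lemma eigenvalue_moduli_le f eta (mu : 'I_n -> R) : (forall i, 0 < mu i) ->
  (forall i, wle mu (eta * mu i) (tnth f i)) -> ubound (eigenvalue_moduli f) eta.
Proof.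
move=> mu0 feta _ [M [xi [Mf /eigenvalueP [v vM vn0] <-]]].
pose a i := ComplexField.Normc.normc (v 0 i).
have a0 i : 0 <= a i by rewrite /a; case: (v 0 i) => x y; apply: sqrtr_ge0.
have S0 : 0 < \sum_i a i * mu i.
  have /rV0Pn [i vi] := vn0.
  rewrite (bigD1 i) //= ltr_wpDr ?sumr_ge0 // => [j _|]; first by rewrite mulr_ge0 // ltW.
  rewrite mulr_gt0 // lt_neqAle a0 andbT eq_sym; apply: contra vi => /eqP.
  by move/ComplexField.Normc.eq0_normc => ->.
rewrite -(ler_pM2r S0) !mulr_sumr.
have step j : ComplexField.Normc.normc xi * a j <= \sum_i a i * (M i j)%:R.
  rewrite -ComplexField.Normc.normcM.
  have -> : xi * v 0 j = \sum_i v 0 i * (M i j)%:R.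
    have := congr1 (fun w : 'rV_n => w 0 j) vM; rewrite !mxE => <-.
    by apply: eq_bigr => i _; rewrite mxE.
  elim/big_ind2: _ => [|x1 x2 y1 y2 h1 h2|i _].
  - by rewrite ComplexField.Normc.normc0.
  - by apply: le_trans (@le_normcD R _ _) _; apply: lerD.
  - rewrite mulr_natr (@normcMn R) mulr_natr //.
apply: (@le_trans _ _ (\sum_j (\sum_i a i * (M i j)%:R) * mu j)).
  by apply: ler_sum => j _; rewrite mulrA ler_wpM2r // ltW.
under eq_bigr do rewrite mulr_suml.
rewrite exchange_big /=; apply: ler_sum => i _.
have /feta : [multinom M i j | j < n] \in msupp (tnth f i) by rewrite mcoeff_msupp Mf.
move=> le; rewrite [leRHS]mulrCA; under eq_bigr do rewrite -mulrA.
rewrite -mulr_sumr ler_wpM2l //; apply: le_trans le.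
by rewrite le_eqVlt; apply/orP; left; apply/eqP; apply: eq_bigr => j _; rewrite mnmE.
Qed.

(** The exponents of the monomials [F i] form the rows of a contained matrix that has [mu] as a
    column eigenvector. *)
Lemma eigenvalue_moduli_contained f th (mu : 'I_n -> R) (F : 'I_n -> 'X_{1..n}) :
  0 <= th -> (exists i, mu i != 0) ->
  (forall i, F i \in msupp (tnth f i) /\ wt mu (F i) = th * mu i) ->
  eigenvalue_moduli f th.
Proof.
move=> th0 [i0 mui0] fF; exists (\matrix_(i, j) F i j), (th%:C)%C; split.
- move=> i; rewrite (_ : [multinom _ | j < n] = F i) -?mcoeff_msupp; first by have [] := fF i.
  by apply/mnmP => j; rewrite mnmE mxE.
(* [eigenvalue] refers to row vectors while [mu] gives a column, hence the detour through the
   singularity of the matrix minus [th]. *)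
- rewrite /eigenvalue kermx_eq0 row_free_unit; apply/negP => u.
  pose w : 'cV[R[i]]_n := \col_i ((mu i)%:C)%C.
  have w0 : w = 0.
    rewrite -[w](mulKmx u) [X in _ *m X](_ : _ = 0) ?mulmx0 //.
    apply/matrixP => i j; rewrite mulmxBl mul_scalar_mx !mxE.
    apply/eqP; rewrite subr_eq0; apply/eqP.
    have [_ e] := fF i; rewrite -rmorphM -e /wt rmorph_sum.
    by apply: eq_bigr => j' _; rewrite !mxE rmorphM /= rmorph_nat.
  have /eqP := congr1 (fun w : 'cV_n => w i0 0) w0; rewrite !mxE.
  by rewrite -(rmorph0 (real_complex R)) (inj_eq (fmorph_inj _)) (negbTE mui0).
- by rewrite /= expr0n addr0 sqrtr_sqr ger0_norm.
Qed.

End Eigenvalues.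

(** * Limits of r-th roots *)

Section RootLimit.
Variable (R : realType).
Local Open Scope classical_set_scope.

Lemma expr_unbounded (q K : R) : 1 < q -> \forall r \near \oo, K <= q ^+ r.
Proof.
move=> q1; have q0 : 0 < q by apply: lt_trans q1.
have : (fun r => q^-1 ^+ r) @ \oo --> (0 : R).
  by apply: cvg_expr; rewrite gtr0_norm ?invr_gt0 // invf_lt1.
pose e := (`|K| + 1)^-1.
have K0 : 0 < `|K| + 1 by rewrite ltr_wpDl.
have e0 : 0 < e by rewrite invr_gt0.
move/cvgrPdist_lt => /(_ e e0); apply: filterS => r.
rewrite sub0r normrN gtr0_norm ?exprn_gt0 ?invr_gt0 // exprVn ltf_pV2 ?posrE ?exprn_gt0 //.
by move=> lt; apply: ltW; apply: le_lt_trans lt; apply: le_trans (ler_norm K) _; rewrite lerDl.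
Qed.

Lemma root_cvg (u : nat -> R) (th : R) : 1 <= th -> (forall r, 0 <= u r) ->
  (exists2 c : R, 0 < c & forall r, c * th ^+ r <= u r) ->
  (forall eta, th < eta -> exists2 C : R, 0 < C & forall r, u r <= C * eta ^+ r) ->
  (fun r => u r `^ (r%:R)^-1) @ \oo --> th.
Proof.
move=> th1 u0 [c c0 cu] uC; have th0 : 0 < th by apply: lt_le_trans th1.
have rootE (x : R) r : 0 <= x -> (0 < r)%N -> (x ^+ r) `^ (r%:R)^-1 = x.
  move=> x0 r0; rewrite -powR_mulrn // -powRrM divff ?powRr1 //.
  by rewrite pnatr_eq0 -lt0n.
apply/cvgrPdist_le => e e0.
(* With only half of [e] spent, the powers of [(th + e) / (th + e / 2)] eventually absorb [C]. *)
have [C C0 uleC] := uC (th + e / 2) (ltac:(lra)).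
have h1 : \forall r \near \oo, C <= ((th + e) / (th + e / 2)) ^+ r.
  by apply: expr_unbounded; rewrite ltr_pdivlMr; lra.
have h2 : \forall r \near \oo, c^-1 <= ((th + e) / th) ^+ r.
  by apply: expr_unbounded; rewrite ltr_pdivlMr; lra.
near=> r.
have r0 : (0 < r)%N by near: r; exists 1%N.
have up : u r `^ (r%:R)^-1 <= th + e.
  rewrite -[leRHS](rootE _ r) //; last lra.
  apply: ge0_ler_powR; rewrite ?nnegrE ?invr_ge0 ?exprn_ge0 //; first lra.
  apply: le_trans (uleC r) _; rewrite -ler_pdivlMr ?exprn_gt0 //; last lra.
  by rewrite -expr_div_n; near: r.
(* The powers of [th / (th + e)] eventually drop below [c], and [th ^+ 2 / (th + e)] is still at
   least [th - e]. *)
have lo : th * (th / (th + e)) <= u r `^ (r%:R)^-1.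
  have q0 : 0 <= th * (th / (th + e)) by rewrite mulr_ge0 ?divr_ge0 //; lra.
  rewrite -[leLHS](rootE _ r) //.
  apply: ge0_ler_powR; rewrite ?nnegrE ?invr_ge0 ?exprn_ge0 //.
  apply: le_trans (cu r); rewrite exprMn mulrC ler_wpM2r ?exprn_ge0 ?(ltW th0) //.
  rewrite -[leRHS]invrK -[leLHS]invrK lef_pV2 ?posrE ?invr_gt0 ?exprn_gt0 ?divr_gt0 //; [|lra].
  by rewrite -exprVn invf_div; near: r.
have : th - e <= th * (th / (th + e)).
  by rewrite mulrA ler_pdivlMr; [nra|lra].
by move=> h; rewrite ler_norml; apply/andP; split; lra.
Unshelve. all: by end_near.
Qed.

End RootLimit.

(** * Permutation-triangular maps with controlled growth *)

Lemma is_handelman_quadratic (R : realType) (th : R) (a b : nat) :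
  0 < th -> th ^+ 2 = a%:R * th + b%:R -> is_handelman th.
Proof.
move=> th0 e; split=> //; pose s : seq int := [:: - b%:Z; - a%:Z; 1].
have sE : Poly s = s :> seq int by rewrite (@PolyK _ 0).
exists (Poly s); split.
- by rewrite monicE lead_coefE sE.
- by case=> [|[|i]]; rewrite sE //= oppr_le0.
- rewrite /root map_polyE sE horner_Poly /= !rmorphN /=; apply/eqP.
  by move: e; rewrite expr2 -!pmulrn => e; ring: e.
Qed.

Section Shape.
Variables (k : fieldType) (n : nat).
Implicit Types (f : endo k n) (p : {mpoly k[n]}).

Definition below (i : nat) p :=
  forall m, m \in msupp p -> forall j : 'I_n, (i <= j)%N -> m j = 0%N.

(** The form of a component of a triangular automorphism, a nonzero multiple of x_j plus a
    polynomial in earlier variables. It is phrased through the support because weights only see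
    monomials. *)
Definition shape_at (j : 'I_n) p :=
  U_(j)%MM \in msupp p /\
  forall m, m \in msupp p -> m = U_(j)%MM \/ forall l : 'I_n, (j <= l)%N -> m l = 0%N.

Definition shaped (s : 'I_n -> 'I_n) f := injective s /\ forall i, shape_at (s i) (tnth f i).

Lemma shaped_permutation_triangular s f : shaped s f -> permutation_triangular f.
Proof.
move=> [s_inj sf].
exists [tuple 'X_(s i) | i < n], [tuple tnth f (invF s_inj j) | j < n]; split.
- move=> p; apply/tnthP/tnthP => -[i ->]; rewrite !tnth_mktuple.
    by exists (s i); rewrite tnth_endo_id.
  by exists (invF s_inj i); rewrite !tnth_mktuple f_invF.
- move=> i m; rewrite tnth_mktuple => mf j ij.
  have [_] := sf (invF s_inj i); rewrite f_invF => /(_ _ mf) [->|/(_ j (ltnW ij))//].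
  by rewrite mnm1E; case: eqP ij => // ->; rewrite ltnn.
- apply: eq_from_tnth => i.
  by rewrite tnth_endo_comp tnth_mktuple comp_mpolyXE tnth_mktuple invF_f.
Qed.

End Shape.

Section Conclusion.
Variables (R : realType) (k : fieldType).

(* The third clause bounds the maximal eigenvalue and the degree growth from above: it
   uses weights depending on [eta] because maximal eigenvectors may have zero entries. *)
Definition tame n (f : endo k n) (th : R) : Prop :=
  [/\ 1 <= th,
      exists a b : nat, th ^+ 2 = a%:R * th + b%:R,
      forall eta, th < eta -> exists2 mu : 'I_n -> R, forall i, 0 < mu i &
        forall i, wle mu (eta * mu i) (tnth f i) &
      th = 1 \/
      (exists2 mu, weight_eigen f th mu & exists i, mu i != 0) /\
      (forall mu, weight_eigen f th mu -> (exists i, mu i != 0) -> top_survives f th mu)].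

Lemma tame_conclusion n (f f' : endo k n.+1) s th : is_aut f -> aut_conjugate f f' ->
  shaped s f' -> tame f' th ->
  [/\ is_maximal_eigenvalue f' th,
      th = 1 \/ (forall mu : 'rV[R]_n.+1,
         is_maximal_eigenvector f' th mu -> algebraically_stable mu f'),
      is_dynamical_degree f th, is_dynamical_degree f' th & is_handelman th].
Proof.
move=> f_aut ff' sf' [th1 [a [b ab]] up cases].
have th0 : 0 < th by apply: lt_le_trans th1.
have f'_aut := aut_conjugate_aut ff' f_aut.
have upper g : aut_conjugate f' g -> forall eta, th < eta ->
    exists2 C : R, 0 < C & forall r, (endo_deg (endo_iter g r))%:R <= C * eta ^+ r.
  move=> f'g eta theta; have [mu mu0 fmu] := up _ theta.
  have eta0 : 0 <= eta by apply: ltW; apply: lt_trans theta.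
  have [C C0 bound] := weight_bound_growth mu0 eta0 fmu.
  have [D D0 gf'] := endo_deg_iter_conj f'g.
  exists (D%:R * C) => [|r]; first by rewrite mulr_gt0 // ltr0n.
  rewrite -mulrA; apply: le_trans (_ : D%:R * (endo_deg (endo_iter f' r))%:R <= _).
    by rewrite -natrM ler_nat.
  by rewrite ler_wpM2l.
have lower' : exists2 c : R, 0 < c &
    forall r, c * th ^+ r <= (endo_deg (endo_iter f' r))%:R.
  case: cases => [->|[[mu mu_eigen mu_neq0] surv]].
    (* Each iterate is an automorphism, so its degree is at least 1. *)
    exists 1 => // r; rewrite expr1n mulr1 ler1n.
    by apply: endo_deg_aut_gt0 => //; apply: endo_iter_aut.
  have [mu0 _ _] := mu_eigen.
  by apply: (@top_survives_growth _ _ _ _ _ mu) => //; [exact: ltW|exact: surv].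
have lower g : aut_conjugate f' g -> exists2 c : R, 0 < c &
    forall r, c * th ^+ r <= (endo_deg (endo_iter g r))%:R.
  move=> /aut_conjugate_sym f'g; have [c c0 bound] := lower'.
  have [D D0 gf'] := endo_deg_iter_conj f'g.
  exists (c / D%:R) => [|r]; first by rewrite divr_gt0 // ltr0n.
  rewrite mulrAC ler_pdivrMr ?ltr0n //; apply: le_trans (bound r) _.
  by rewrite -natrM ler_nat mulnC.
have dyn g : aut_conjugate f' g -> is_dynamical_degree g th.
  by move=> f'g; exact: (root_cvg th1 (fun r => ler0n R _) (lower g f'g) (upper g f'g)).
split.
- split; last first.
    move=> t ft; rewrite leNgt; apply/negP => tht.
    have [mu mu0 fmu] := up ((th + t) / 2) (ltac:(lra)).
    have := eigenvalue_moduli_le mu0 fmu ft; lra.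
  case: cases => [->|[[mu [mu0 _ mu_eigen] mu_neq0] surv]].
    (* The leading variables form a contained permutation matrix, which fixes the constant vector
       1. *)
    apply: (@eigenvalue_moduli_contained _ _ _ _ _ (fun=> 1) (fun i => U_(s i)%MM)) => //.
      by exists ord0; apply: oner_neq0.
    by move=> i; split; [have [_ /(_ i) []] := sf'|rewrite wtU mulr1].
  apply: (@eigenvalue_moduli_contained _ _ _ _ _ mu
           (fun i => projT1 (cid2 (mu_eigen i)))) => [|//|i]; first exact: ltW.
  by case: (cid2 _).
- case: cases => [->|[_ surv]]; [by left|right=> mu mu_eig].
  have [mu_eigen mu_neq0] := maximal_eigenvector_weight mu_eig.
  have [mu0 muf _] := mu_eigen.
  by apply: (@top_survives_stable _ _ _ _ th) => //; [exact: ltW|exact: surv].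
- by apply: dyn; apply: aut_conjugate_sym.
- by apply: dyn; apply: aut_conjugate_refl.
- exact: is_handelman_quadratic ab.
Qed.

End Conclusion.

(** * Largest roots of finitely many quadratics *)

Section Thresholds.
Variable R : realType.

Lemma quadratic_root (t : R) (a b : nat) : 1 <= t -> t ^+ 2 < a%:R * t + b%:R ->
  exists2 th : R, t < th & th ^+ 2 = a%:R * th + b%:R.
Proof.
move=> t1 lt; have a0 : 0 <= a%:R :> R by []. have b0 : 0 <= b%:R :> R by [].
pose D : R := a%:R ^+ 2 + b%:R *+ 4.
have D0 : 0 <= D by rewrite addr_ge0 ?sqr_ge0 // mulrn_wge0.
have sD := sqr_sqrtr D0; have s0 := sqrtr_ge0 D.
exists ((a%:R + Num.sqrt D) / 2); last by rewrite /D in sD *; nra.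
by rewrite /D in sD *; nra.
Qed.

(** A pair (a, b) stands for X^2 - a X - b. If the next quadratic is negative at the current [th],
    its larger root replaces [th]; the earlier inequalities persist to the right of [th]. *)
Lemma threshold (t : R) (S : seq (nat * nat)) : 1 <= t ->
  exists th : R, [/\ t <= th,
    forall ab, ab \in S -> ab.1%:R * th + ab.2%:R <= th ^+ 2 &
    th = t \/ exists2 ab, ab \in S & th ^+ 2 = ab.1%:R * th + ab.2%:R].
Proof.
move=> t1; elim: S => [|[a b] S [th [tth thS thE]]]; first by exists t; split=> //; left.
have [le|lt] := leP (a%:R * th + b%:R) (th ^+ 2).
  exists th; split=> // [ab|]; first by rewrite inE => /predU1P[->//|/thS].
  by case: thE => [->|[ab abS e]]; [left|right; exists ab => //; rewrite inE abS orbT].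
have [th' ltth e] := quadratic_root (le_trans t1 tth) lt.
exists th'; split=> [|ab|]; first by apply: le_trans tth (ltW _).
  rewrite inE => /predU1P[->|/thS le] /=; first by rewrite e.
  have a0 : 0 <= ab.1%:R :> R by []. have b0 : 0 <= ab.2%:R :> R by [].
  have : ab.1%:R <= th by nra.
  by nra.
by right; exists (a, b); rewrite ?inE ?eqxx.
Qed.

(** The inequality forces [a <= th], and x (x - a) increases for x at least a. *)
Lemma threshold_mono (th eta : R) (a b : nat) : 1 <= th -> th <= eta ->
  a%:R * th + b%:R <= th ^+ 2 -> a%:R * eta + b%:R <= eta ^+ 2.
Proof.
move=> th1 le; have a0 : 0 <= a%:R :> R by []. have b0 : 0 <= b%:R :> R by [].
move=> e; have : a%:R <= th by nra.
by nra.
Qed.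

Lemma seq_max (T : eqType) (s : seq T) (F : T -> R) x : x \in s ->
  exists2 y, y \in s & forall z, z \in s -> F z <= F y.
Proof.
elim: s x => // x s IH _ _; case: s IH => [|y s] IH.
  by exists x; rewrite ?inE // => z; rewrite inE => /eqP ->.
have [z zs zmax] := IH y (mem_head _ _).
have [le|lt] := leP (F x) (F z).
  by exists z => [|w]; rewrite in_cons ?zs ?orbT // => /predU1P[->|/zmax].
exists x => [|w]; rewrite in_cons ?eqxx // => /predU1P[->//|/zmax ws].
exact: le_trans ws (ltW lt).
Qed.

End Thresholds.

(** * Nonvanishing of iterated top parts *)

Section Survival.
Variables (R : realType) (k : fieldType) (n : nat) (f : endo k n).
Variables (th : R) (mu : 'I_n -> R).
Hypotheses (th0 : 0 < th) (mu_f : forall i, wle mu (th * mu i) (tnth f i)).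

Section Orbit.
Variables (S : comNzRingType) (h : {rmorphism k -> S}) (v : 'I_n -> S).

(** The orbit of the point [v] under the top part of [f]; ring and starting point are chosen anew in
    each application. *)
Fixpoint top_orbit r : 'I_n -> S :=
  if r is r'.+1 then fun i => mmap h (top_orbit r') (wtop mu (th * mu i) (tnth f i))
  else v.

Lemma top_orbit_survives i : 0 < mu i -> (forall r, top_orbit r i != 0) ->
  top_survives f th mu.
Proof.
move=> mui orb r; exists i; split=> //.
by apply: (wtop_iter_neq0 th0 mu_f (h := h) (V := top_orbit)).
Qed.

Lemma top_orbitS r i : top_orbit r.+1 i =
  \sum_(m <- msupp (tnth f i) | wt mu m == th * mu i) h (tnth f i)@_m * mmap1 (top_orbit r) m.
Proof. by rewrite /= mmap_wtop. Qed.

End Orbit.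

(* Restricting to the coordinate subspace where the variables in [Z] vanish, which
   the top part of [f] preserves, its [i]-th component becomes the monomial [m0]. *)
Lemma monomial_top_survives (Z : pred 'I_n) (i : 'I_n) (m0 : 'X_{1..n}) :
  0 < mu i -> ~~ Z i -> m0 \in msupp (tnth f i) -> wt mu m0 = th * mu i ->
  (forall j, j != i -> m0 j = 0%N) ->
  (forall m, m \in msupp (tnth f i) -> wt mu m = th * mu i ->
     m = m0 \/ exists2 j, Z j & m j != 0%N) ->
  (forall j, Z j -> forall m, m \in msupp (tnth f j) -> wt mu m = th * mu j ->
     exists2 j', Z j' & m j' != 0%N) ->
  top_survives f th mu.
Proof.
move=> mui Zi m0f wm0 m0E mi mZ.
(* The starting point has coordinates 0 on [Z] and 1 elsewhere. *)
pose V := top_orbit idfun (fun j => (~~ Z j)%:R).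
have mmap1_0 r (m : 'X_{1..n}) : (exists2 j, Z j & m j != 0%N) -> (forall j, Z j -> V r j = 0) ->
    mmap1 (V r) m = 0.
  move=> [j Zj mj] VZ; rewrite /mmap1 (bigD1 j) //= VZ //.
  by rewrite expr0n (negbTE mj) mul0r.
(* As the coordinates in [Z] stay zero, only [m0] contributes to the [i]-th one: a nonzero scalar
   times a power of its previous value. *)
suff VE r : V r i != 0 /\ forall j, Z j -> V r j = 0.
  by apply: (top_orbit_survives (h := idfun) (v := fun j => (~~ Z j)%:R) mui) => r; have [] := VE r.
elim: r => [|r [Vi VZ]]; first by rewrite /V /= Zi oner_neq0; split=> // j ->.
split=> [|j Zj]; rewrite /V top_orbitS.
  rewrite -big_filter (bigD1_seq m0) ?filter_uniq ?msupp_uniq //=; last first.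
    by rewrite mem_filter m0f wm0 eqxx.
  rewrite big_seq_cond big1 ?addr0 => [|m /andP[]]; last first.
    rewrite mem_filter => /andP[/eqP wm mf] mm0.
    by case: (mi m mf wm) mm0 => [->|/mmap1_0 -> //]; rewrite ?eqxx ?mulr0.
  rewrite mulf_neq0 -?mcoeff_msupp // /mmap1 (bigD1 i) //= big1 ?mulr1 ?expf_neq0 //.
  by move=> j ji; rewrite m0E.
rewrite big_seq_cond big1 // => m /andP[mf /eqP wm].
by rewrite [mmap1 _ _]mmap1_0 ?mulr0 //; apply: mZ wm.
Qed.

Lemma mmap_rmorph_iter (S : comNzRingType) (h : {rmorphism k -> S})
    (g : {rmorphism S -> S}) (v : 'I_n -> S) (q : {mpoly k[n]}) r :
  (forall c, g (h c) = h c) -> iter r g (mmap h v q) = mmap h (fun i => iter r g (v i)) q.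
Proof.
move=> gh; elim: r => [|r IH]; first exact: erefl.
by rewrite iterS IH (mmap_rmorph _ _ gh).
Qed.

(* The top part of [f] restricts to a dominant map of the [(u, v)]-plane: its [u]-th
   component involves [v], and its [v]-th component is a nonconstant monomial in [u]. *)
Lemma dominant_top_survives (u v : 'I_n) (mv : 'X_{1..n}) : u != v -> 0 < mu u ->
  (forall m, m \in msupp (tnth f u) -> wt mu m = th * mu u ->
     forall j, j != u -> j != v -> m j = 0%N) ->
  (exists2 m, m \in msupp (tnth f u) & wt mu m = th * mu u /\ m v != 0%N) ->
  mv \in msupp (tnth f v) -> wt mu mv = th * mu v -> mv u != 0%N ->
  (forall j, j != u -> mv j = 0%N) ->
  (forall m, m \in msupp (tnth f v) -> wt mu m = th * mu v -> m = mv) ->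
  top_survives f th mu.
Proof.
move=> uv muu fuE [mu' mu'f [wmu' mu'v]] mvf wmv mvu mvE fvE.
pose h : {rmorphism k -> {poly {poly k}}} := polyC \o polyC.
(* The generic point of the plane: u is the inner variable 'Y, v the outer variable 'X. *)
pose v0 j : {poly {poly k}} := if j == u then 'Y else if j == v then 'X else 0.
pose V := top_orbit h v0.
pose plane (q : {mpoly k[n]}) := forall m, m \in msupp q ->
  forall j, j != u -> j != v -> m j = 0%N.
have planeu : plane (wtop mu (th * mu u) (tnth f u)).
  by move=> m; rewrite msupp_wtop => /andP[mf /eqP wm]; apply: fuE.
have planev : plane (wtop mu (th * mu v) (tnth f v)).
  move=> m; rewrite msupp_wtop => /andP[mf /eqP wm] j ju _.
  by rewrite (fvE m) // mvE.
pose Q := V 1%N u; pose q := (tnth f v)@_mv *: 'X^(mv u) : {poly k}.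
have size_q : (1 < size q)%N.
  by rewrite size_scale -?mcoeff_msupp // size_polyXn ltnS lt0n.
have mmap1E (m : 'X_{1..n}) : (forall j, j != u -> j != v -> m j = 0%N) ->
    mmap1 v0 m = ('X ^+ m u)%:P * 'X ^+ m v.
  move=> mE; rewrite /mmap1 (bigD1 u) //= (bigD1 v) 1?eq_sym //= big1 => [|j /andP[ju jv]].
    by rewrite /v0 eqxx eq_sym (negbTE uv) eqxx mulr1 rmorphXn.
  by rewrite mE // expr0.
have VvE : V 1%N v = q%:P.
  rewrite /V top_orbitS -big_filter (bigD1_seq mv) ?filter_uniq ?msupp_uniq //=; last first.
    by rewrite mem_filter mvf wmv eqxx.
  rewrite big_seq_cond big1 ?addr0 => [|m /andP[]]; last first.
    by rewrite mem_filter => /andP[/eqP wm mf]; rewrite (fvE m) ?eqxx.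
  rewrite mmap1E => [|j ju _]; last exact: mvE.
  by rewrite (mvE v) 1?eq_sym // expr0 mulr1 -polyCM mul_polyC.
(* Plane monomials are told apart by their exponents at u and v, so the term of [mu'], which
   involves v, cannot cancel in [Q]. *)
have size_Q : (1 < size Q)%N.
  rewrite ltnNge; apply/negP => Q1.
  have : Q`_(mu' v)`_(mu' u) = 0.
    by rewrite (_ : Q`_(mu' v) = 0) ?coef0 // nth_default // (leq_trans Q1) // lt0n.
  rewrite /Q /V top_orbitS coef_sum coef_sum -big_filter (bigD1_seq mu') /=; last first.
  - by rewrite filter_uniq ?msupp_uniq.
  - by rewrite mem_filter mu'f wmu' eqxx.
  have coefE m : m \in [seq m <- msupp (tnth f u) | wt mu m == th * mu u] ->
      (h (tnth f u)@_m * mmap1 (top_orbit h v0 0) m)`_(mu' v)`_(mu' u) =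
      (tnth f u)@_m *+ ((mu' u == m u) && (mu' v == m v)).
    rewrite mem_filter => /andP[/eqP wm mf].
    rewrite mmap1E => [|j ju jv]; last exact: fuE wm j ju jv.
    rewrite /h /= mulrA -polyCM coefMXn; have [lt|le] := ltnP (mu' v) (m v).
      by rewrite coef0 (ltn_eqF lt) andbF.
    rewrite coefC subn_eq0 leq_eqVlt [(mu' v < m v)%N]ltnNge le orbF.
    case: eqP => _; last by rewrite andbF coef0.
    by rewrite andbT mul_polyC coefZ coefXn mulr_natr.
  rewrite coefE; last by rewrite mem_filter mu'f wmu' eqxx.
  rewrite !eqxx big_seq_cond big1 ?addr0 => [/eqP|m /andP[ms mmu']].
    by rewrite mulr1n mcoeff_eq0 mu'f.
  rewrite coefE //; case: andP => // -[/eqP e1 /eqP e2].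
  case/eqP: mmu'; apply/mnmP => j.
  have [->//|ju] := eqVneq j u; have [->//|jv] := eqVneq j v.
  move: ms; rewrite mem_filter => /andP[/eqP wm mf].
  by rewrite (fuE m) // (fuE mu').
(* [G] is the pullback along the plane map: it fixes [k] and sends 'Y to [Q] and 'X to [q]. *)
pose G : {rmorphism {poly {poly k}} -> {poly {poly k}}} :=
  comp_poly Q \o map_poly (comp_poly q) \o swapXY.
have GY : G 'Y = Q by rewrite /G /= swapXY_Y map_polyX comp_polyX.
have GX : G 'X = q%:P by rewrite /G /= swapXY_X map_polyC /= comp_polyX comp_polyC.
have Gh c : G (h c) = h c.
  by rewrite /G /h /= swapXY_polyC map_polyC /= map_polyC /= comp_polyC comp_polyC.
(* Dominance: [Q] is nonconstant in the outer variable and [q] in the inner one, so neither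
   substitution kills a nonzero polynomial. *)
have G_inj a : a != 0 -> G a != 0.
  move=> a0; rewrite /G /= comp_poly_eq0 // map_poly_eq0_id0.
    by rewrite swapXY_eq0.
  by rewrite comp_poly_eq0 // lead_coef_eq0 swapXY_eq0.
pose Gr r : {poly {poly k}} -> {poly {poly k}} := iter r G.
have Gr_mmap r p : Gr r (mmap h v0 p) = mmap h (fun j => Gr r (v0 j)) p.
  exact: mmap_rmorph_iter.
(* Only the coordinates u and v of the orbit are ever read, since both top parts involve no other
   variable. *)
have VE r j : j = u \/ j = v -> V r j = Gr r (v0 j).
  elim: r j => [//|r IH] j juv; rewrite /V /= -/V.
  transitivity (Gr r (mmap h v0 (wtop mu (th * mu j) (tnth f j)))).
    rewrite Gr_mmap; apply: eq_mmap => m i mf mi; apply: IH.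
    have [->|iu] := eqVneq i u; first by left.
    have [->|iv] := eqVneq i v; first by right.
    move: mi; suff -> : m i = 0%N by [].
    by case: juv mf => -> => [/planeu|/planev]; apply.
  rewrite [RHS](iterSr r G (v0 j)); congr (iter r _ _).
  case: juv => ->; rewrite /v0; last by rewrite eq_sym (negbTE uv) eqxx GX -VvE.
  by rewrite eqxx GY.
apply: (top_orbit_survives (h := h) (v := v0) muu) => r.
rewrite -/V VE /Gr; last by left.
elim: r => [|r IH] /=; last exact: G_inj.
by rewrite /v0 eqxx polyC_eq0 polyX_eq0.
Qed.

End Survival.

(** * The orders of the components in three variables *)

Notation ix := (@Ordinal 3 0 isT).
Notation iy := (@Ordinal 3 1 isT).
Notation iz := (@Ordinal 3 2 isT).

Lemma ord3P (P : 'I_3 -> Prop) : P ix -> P iy -> P iz -> forall i, P i.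
Proof.
move=> Px Py Pz [[|[|[|i]]] lti] //.
- by rewrite (_ : Ordinal lti = ix) //; apply: val_inj.
- by rewrite (_ : Ordinal lti = iy) //; apply: val_inj.
- by rewrite (_ : Ordinal lti = iz) //; apply: val_inj.
Qed.

Lemma mnm3P (m m' : 'X_{1..3}) : m ix = m' ix -> m iy = m' iy -> m iz = m' iz -> m = m'.
Proof. by move=> ex ey ez; apply/mnmP; apply: ord3P. Qed.

Lemma wt3E (R : realFieldType) (mu : 'I_3 -> R) (m : 'X_{1..3}) :
  wt mu m = (m ix)%:R * mu ix + (m iy)%:R * mu iy + (m iz)%:R * mu iz.
Proof.
rewrite /wt !big_ord_recl big_ord0 addr0 addrA.
have -> : lift ord0 (lift ord0 ord0) = iz :> 'I_3 by apply: val_inj.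
have -> : lift ord0 ord0 = iy :> 'I_3 by apply: val_inj.
by have -> : ord0 = ix :> 'I_3 by apply: val_inj.
Qed.

Section ThreeVariables.
Variables (R : realType) (k : fieldType).
Implicit Types (p : {mpoly k[3]}) (f : endo k 3) (mu : 'I_3 -> R) (m : 'X_{1..3}).

Definition vec3 (a b c : R) : 'I_3 -> R := fun i => nth 0 [:: a; b; c] i.

Lemma shape_x p m : shape_at ix p -> m \in msupp p -> m = U_(ix)%MM \/ m = 0%MM.
Proof.
move=> [_ H] /H [->|e]; [by left|right; apply/mnmP => j].
by rewrite mnm0E e.
Qed.

Lemma shape_y p m : shape_at iy p -> m \in msupp p ->
  m = U_(iy)%MM \/ (m iy = 0%N /\ m iz = 0%N).
Proof. by move=> [_ H] /H [->|e]; [left|right; rewrite !e]. Qed.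

Lemma shape_z p m : shape_at iz p -> m \in msupp p -> m = U_(iz)%MM \/ m iz = 0%N.
Proof. by move=> [_ H] /H [->|e]; [left|right; rewrite !e]. Qed.

Lemma wle_shape_x mu D p : shape_at ix p -> 0 <= D -> mu ix <= D -> wle mu D p.
Proof. by move=> px D0 xD m /(shape_x px) [->|->]; rewrite ?wtU ?wt0. Qed.

Lemma wle_shape_y mu D p : shape_at iy p -> mu iy <= D ->
  (forall m, m \in msupp p -> m iy = 0%N -> m iz = 0%N -> (m ix)%:R * mu ix <= D) ->
  wle mu D p.
Proof.
move=> py yD xD m mp; have [->|[my mz]] := shape_y py mp; first by rewrite wtU.
by rewrite wt3E my mz !mul0r !addr0 xD.
Qed.

Lemma wle_shape_z mu D p : shape_at iz p -> mu iz <= D ->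
  (forall m, m \in msupp p -> m iz = 0%N ->
     (m ix)%:R * mu ix + (m iy)%:R * mu iy <= D) ->
  wle mu D p.
Proof.
move=> pz zD xyD m mp; have [->|mz] := shape_z pz mp; first by rewrite wtU.
by rewrite wt3E mz mul0r addr0 xyD.
Qed.

Lemma exponent_max p (i : 'I_3) : exists d : nat,
  (forall m, m \in msupp p -> (m i <= d)%N) /\
  (d != 0%N -> exists2 m, m \in msupp p & m i = d).
Proof.
case E : (msupp p) => [|m0 s]; first by exists 0%N; split.
have [m ms mmax] := @seq_max R _ (m0 :: s) (fun m => (m i)%:R) m0 (mem_head _ _).
exists (m i); split=> [m' /mmax|_]; last by exists m.
by rewrite ler_nat.
Qed.

Lemma wt_bound mu p : exists2 N : R, 0 <= N & wle mu N p.
Proof.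
case E : (msupp p) => [|m0 s]; first by exists 0 => // m; rewrite E.
have [m ms mmax] := @seq_max R _ (m0 :: s) (wt mu) m0 (mem_head _ _).
exists `|wt mu m| => // m'; rewrite E => /mmax le.
exact: le_trans le (ler_norm _).
Qed.

(** Used when [b] is the weight of the leading variable of a component and [t * a] the bound on that
    component: this variable is then too light to be on top. *)
Lemma mul_gt1_lt (t a b : R) : 1 < t -> 0 < a -> t * b = a -> b < t * a.
Proof.
move=> t1 a0 tb; have b0 : 0 < b by nra.
by apply: (@lt_trans _ _ a); nra.
Qed.

(** The component is a x + e. If its constant term carries the top, the bound is 0 and x has weight
    0 as well. *)
Lemma eigen_shape_x f (th : R) mu i : 0 < th -> shape_at ix (tnth f i) ->
  weight_eigen f th mu -> th * mu i = mu ix.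
Proof.
move=> th0 fx [mu0 le /(_ i) [m mf wm]].
have : mu ix <= th * mu i by have [/le] := fx; rewrite wtU.
move: (mu0 ix) wm; case: (shape_x fx mf) => ->; rewrite ?wtU ?wt0; lra.
Qed.

Lemma tame_one f : (forall eta, 1 < eta -> exists2 mu : 'I_3 -> R, forall i, 0 < mu i &
    forall i, wle mu (eta * mu i) (tnth f i)) -> tame f (1 : R).
Proof. by move=> up; split=> //; [exists 0%N, 1%N; lra|left]. Qed.

(** Weights are chosen one variable after the other, each above the weight of every monomial in
    earlier variables of its component. *)
Lemma tame_id f : shape_at ix (tnth f ix) -> shape_at iy (tnth f iy) -> shape_at iz (tnth f iz) ->
  tame f (1 : R).
Proof.
move=> fx fy fz; apply: tame_one => eta eta1.
have [N N0 Nf] := wt_bound (vec3 1 0 0) (tnth f iy).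
have [M M0 Mf] := wt_bound (vec3 1 (N + 1) 0) (tnth f iz).
exists (vec3 1 (N + 1) (M + 1)); first by apply: ord3P; rewrite /vec3 /=; lra.
apply: ord3P; rewrite {2}/vec3 /=.
- by apply: wle_shape_x => //; rewrite /vec3 /=; lra.
- apply: wle_shape_y => // [|m mf my mz]; rewrite /vec3 /=; first by nra.
  by have := Nf _ mf; rewrite wt3E /vec3 /= my mz; nra.
- apply: wle_shape_z => // [|m mf mz]; rewrite /vec3 /=; first by nra.
  by have := Mf _ mf; rewrite wt3E /vec3 /= mz; nra.
Qed.

(** Here x and y form a plane system of Henon type and z follows it; [th] is the maximum of 1 and
    the degree of f_x in x. *)
Lemma tame_swap_xy f : shape_at iy (tnth f ix) -> shape_at ix (tnth f iy) -> shape_at iz (tnth f iz) ->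
  exists th : R, tame f th.
Proof.
move=> fx fy fz; have [d [dmax dex]] := exponent_max (tnth f ix) ix.
have up (eta : R) : 1 < eta -> d%:R <= eta -> exists2 mu : 'I_3 -> R, forall i, 0 < mu i &
    forall i, wle mu (eta * mu i) (tnth f i).
  move=> eta1 etad; have [N N0 Nf] := wt_bound (vec3 eta 1 0) (tnth f iz).
  exists (vec3 eta 1 (N + 1)); first by apply: ord3P; rewrite /vec3 /=; lra.
  apply: ord3P; rewrite {2}/vec3 /=.
  - apply: wle_shape_y => // [|m mf my mz]; rewrite /vec3 /=; first by nra.
    have : (m ix)%:R <= d%:R :> R by rewrite ler_nat dmax.
    by nra.
  - by apply: wle_shape_x => //; rewrite /vec3 /=; lra.
  - apply: wle_shape_z => // [|m mf mz]; rewrite /vec3 /=; first by nra.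
    by have := Nf _ mf; rewrite wt3E /vec3 /= mz; nra.
have [d1|d1] := leqP d 1.
  exists 1; apply: tame_one => eta eta1; apply: up => //.
  by apply: le_trans (ltW eta1); rewrite -[1]/(1%:R) ler_nat.
have d1R : 1 < d%:R :> R by rewrite ltr1n.
have [md mdf mdx] := dex (lt0n_neq0 (ltnW d1)).
have [mdy mdz] : md iy = 0%N /\ md iz = 0%N.
  by case: (shape_y fx mdf) => // e; move: d1; rewrite -mdx e mnm1E.
exists d%:R; split; first exact: ltW.
- by exists d, 0%N; rewrite addr0 expr2.
- by move=> eta etad; apply: up; [apply: lt_trans etad|apply: ltW].
right; split=> [|mu mu_eigen [i mui]].
  have [m0 m0f m0max] := seq_max (wt (vec3 d%:R 1 0)) (proj1 fz).
  (* The weight [c] of z makes the heaviest monomial of f_z exact. Giving z weight 0 in that choice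
     is harmless because [c <= d * c]. *)
  pose c := wt (vec3 d%:R 1 0) m0 / d%:R.
  have c0 : 0 <= c by rewrite divr_ge0 // wt_ge0 //; apply: ord3P; rewrite /vec3 /=; lra.
  have cE : wt (vec3 d%:R 1 0) m0 = d%:R * c by rewrite /c; field; lra.
  exists (vec3 d%:R 1 c); last by exists ix; rewrite /vec3 /=; lra.
  split; apply: ord3P; rewrite ?{2}/vec3 /=; rewrite ?{1}/vec3 /=; try lra.
  - apply: wle_shape_y => // [|m mf my mz]; rewrite /vec3 /=; first by nra.
    have : (m ix)%:R <= d%:R :> R by rewrite ler_nat dmax.
    by nra.
  - by apply: wle_shape_x => //; rewrite /vec3 /=; lra.
  - apply: wle_shape_z => // [|m mf mz]; rewrite /vec3 /=; first by nra.
    by have := m0max _ mf; rewrite cE wt3E /vec3 /= mz; nra.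
  - by exists md => //; rewrite wt3E mdx mdy mdz /vec3 /=; lra.
  - by exists U_(ix)%MM; [case: fy|rewrite wtU /vec3 /=; lra].
  - case: (shape_z fz m0f) => [e|m0z].
      exists m0 => //; move: cE; rewrite e !wtU /vec3 /= => cE; nra.
    by exists m0 => //; rewrite -cE !wt3E m0z /vec3 /=; lra.
have ey := eigen_shape_x (lt_trans ltr01 d1R) fy mu_eigen.
have [mu0 le ex] := mu_eigen.
have mux : 0 < mu ix.
  rewrite lt_neqAle mu0 andbT eq_sym; apply: contra mui => /eqP x0.
  have y0 : mu iy = 0 by nra.
  have z0 : mu iz = 0.
    have [m mf] := ex iz; rewrite wt3E x0 y0; case: (shape_z fz mf) => [->|->].
      by rewrite !mnm1E /=; nra.
    by nra.
  by apply/eqP; move: i; apply: ord3P.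
(* The top part of f_x is a power of x alone: y is too light, and the weight determines the
   exponent. *)
apply: (@monomial_top_survives _ _ _ f d%:R mu _ le pred0 ix md) => //.
- by lra.
- by rewrite wt3E mdx mdy mdz; lra.
- by apply: ord3P.
- move=> m mf wm; left; case: (shape_y fx mf) => [e|[my mz]].
    by have := mul_gt1_lt d1R mux ey; rewrite -wm e wtU ltxx.
  apply: mnm3P; rewrite ?my ?mz // mdx; apply/eqP; rewrite -(eqr_nat R).
  by apply/eqP; move: wm; rewrite wt3E my mz; nra.
Qed.

End ThreeVariables.

Section TameCases.
Variables (R : realType) (k : fieldType).
Implicit Types (f : endo k 3) (m : 'X_{1..3}).

Lemma mmap1_3 (S : comNzRingType) (v : 'I_3 -> S) m :
  mmap1 v m = v ix ^+ m ix * v iy ^+ m iy * v iz ^+ m iz.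
Proof.
rewrite /mmap1 !big_ord_recl big_ord0 mulr1 mulrA.
have -> : lift ord0 (lift ord0 ord0) = iz :> 'I_3 by apply: val_inj.
have -> : lift ord0 ord0 = iy :> 'I_3 by apply: val_inj.
by have -> : ord0 = ix :> 'I_3 by apply: val_inj.
Qed.

(** When [th > 1], x has weight 0 in every maximal eigenvector, so the top part of f_x keeps its
    constant term and that of f_y is L(x) y^e with a polynomial L. Hence the orbit is followed over
    k[X] instead of k. *)
Lemma tame_swap_yz f : shape_at ix (tnth f ix) -> shape_at iz (tnth f iy) ->
  shape_at iy (tnth f iz) -> exists th : R, tame f th.
Proof.
move=> fx fy fz; have [e [emax eex]] := exponent_max R (tnth f iy) iy.
have up (eta : R) : 1 < eta -> e%:R < eta -> exists2 mu : 'I_3 -> R, forall i, 0 < mu i &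
    forall i, wle mu (eta * mu i) (tnth f i).
  move=> eta1 etae; have e0 : 0 <= e%:R :> R by [].
  have [M M0 Mf] := wt_bound (vec3 (1 : R) 0 0) (tnth f iy).
  have [N N0 Nf] := wt_bound (vec3 (1 : R) 0 0) (tnth f iz).
  (* A monomial of f_y requires M + e eta K <= eta^2 K, hence the quotient and the strict inequality
     e < eta. A large [K] makes the weight of x relatively small, as in the eigenvector (0, e,
     1). *)
  pose K := 1 + N + M / (eta * (eta - e%:R)).
  have D0 : 0 < eta * (eta - e%:R) by nra.
  have Q0 : 0 <= M / (eta * (eta - e%:R)) by rewrite divr_ge0 // ltW.
  have KM : M <= K * (eta * (eta - e%:R)) by rewrite /K mulrDl divfK ?gt_eqF //; nra.
  have K1 : 1 <= K by rewrite /K; lra.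
  have KN : N <= K by rewrite /K; lra.
  exists (vec3 1 (eta * K) K); first by apply: ord3P; rewrite /vec3 /=; nra.
  clearbody K; apply: ord3P; rewrite {2}/vec3 /=.
  - by apply: wle_shape_x => //; rewrite /vec3 /=; lra.
  - apply: wle_shape_z => // [|m mf mz]; rewrite /vec3 /=.
      have : K <= eta * K by nra.
      by nra.
    have : (m iy)%:R <= e%:R :> R by rewrite ler_nat emax.
    have := Mf _ mf; rewrite wt3E /vec3 /= mz => mM me.
    have : (m iy)%:R * (eta * K) <= e%:R * (eta * K) by rewrite ler_wpM2r //; nra.
    by nra.
  - apply: wle_shape_y => // m mf my mz; rewrite /vec3 /=.
    have := Nf _ mf; rewrite wt3E /vec3 /= mz my.
    have : K <= eta * K by nra.
    by nra.
have [e1|e1] := leqP e 1.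
  exists 1; apply: tame_one => eta eta1; apply: up => //.
  by apply: le_lt_trans eta1; rewrite -[1]/(1%:R) ler_nat.
have e1R : 1 < e%:R :> R by rewrite ltr1n.
have [me mef mey] := eex (lt0n_neq0 (ltnW e1)).
have mez : me iz = 0%N.
  by case: (shape_z fy mef) => // E; move: e1; rewrite -mey E mnm1E.
exists e%:R; split; first exact: ltW.
- by exists e, 0%N; rewrite addr0 expr2.
- by move=> eta etae; apply: up => //; apply: lt_trans etae.
right; split=> [|mu mu_eigen [i mui]].
  exists (vec3 0 e%:R 1); last by exists iz; rewrite /vec3 /= oner_neq0.
  split; apply: ord3P; rewrite ?{2}/vec3 /=; rewrite ?{1}/vec3 /=; try lra.
  - by apply: wle_shape_x => //; rewrite /vec3 /=; lra.
  - apply: wle_shape_z => // [|m mf mz]; rewrite /vec3 /=; first by nra.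
    have : (m iy)%:R <= e%:R :> R by rewrite ler_nat emax.
    by nra.
  - by apply: wle_shape_y => // [|m mf my mz]; rewrite /vec3 /=; lra.
  - by exists U_(ix)%MM; [case: fx|rewrite wtU /vec3 /=; lra].
  - by exists me => //; rewrite wt3E mey mez /vec3 /=; lra.
  - by exists U_(iy)%MM; [case: fz|rewrite wtU /vec3 /=; lra].
have e0R := lt_trans ltr01 e1R.
have [mu0 le ex] := mu_eigen.
have x0 : mu ix = 0.
  by have := eigen_shape_x e0R fx mu_eigen; have := mu0 ix; nra.
have yz : e%:R * mu iz = mu iy.
  have yle : mu iy <= e%:R * mu iz by have [/le] := fz; rewrite wtU.
  have [m mf] := ex iz; case: (shape_y fz mf) => [->|[my mz]]; first by rewrite wtU.
  by rewrite wt3E x0 my mz; have := mu0 iy; lra.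
have muy : 0 < mu iy.
  rewrite lt_neqAle mu0 andbT eq_sym; apply: contra mui => /eqP y0.
  by apply/eqP; move: i; apply: ord3P => //; nra.
(* The coordinate x starts as the indeterminate and keeps degree 1, so a nonzero [L] evaluated at it
   does not vanish. *)
pose v j : {poly k} := if j == ix then 'X else (j == iy)%:R.
pose V := top_orbit f e%:R mu polyC v.
suff VE r : size (V r ix) = 2 /\ V r iy != 0.
  by apply: (top_orbit_survives e0R le (h := polyC) (v := v) muy) => r; have [] := VE r.
elim: r => [|r [Vx Vy]]; first by rewrite /V /v /= size_polyX oner_neq0.
split.
  have [fxx _] := fx.
  have -> : V r.+1 ix = (tnth f ix)@_U_(ix) *: V r ix + ((tnth f ix)@_0)%:P.
    rewrite /V /= x0 mulr0 -/V.
    have -> : wtop mu 0 (tnth f ix) = (tnth f ix)@_U_(ix) *: 'X_ix + ((tnth f ix)@_0)%:MP.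
      apply/mpolyP => m; rewrite mcoeff_wtop mcoeffD mcoeffZ mcoeffX mcoeffC.
      have [mf|mf] := boolP (m \in msupp (tnth f ix)).
        case: (shape_x fx mf) => ->; rewrite ?wtU ?wt0 ?x0 eqxx /=.
          by rewrite mnm1_eq0 mulr0 addr0 eqxx mulr1.
        by rewrite eqxx mnm1_eq0 mulr0 add0r mulr1.
      rewrite (memN_msupp_eq0 mf) mul0rn.
      have -> : (U_(ix)%MM == m) = false by apply/eqP => E; rewrite -E fxx in mf.
      case: eqP => [E|_]; last by rewrite !mulr0 addr0.
      by rewrite -E (memN_msupp_eq0 mf) mul0r mulr0 addr0.
    by rewrite raddfD /= mmapZ mmapX mmap1U mmapC mul_polyC.
  rewrite size_polyDl ?size_scale -?mcoeff_msupp // Vx.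
  by rewrite size_polyC; case: eqP.
pose L := \sum_(m <- msupp (tnth f iy) | wt mu m == e%:R * mu iy)
  (tnth f iy)@_m *: 'X^(m ix) : {poly k}.
have top_iy m : m \in msupp (tnth f iy) -> wt mu m == e%:R * mu iy -> m iy = e /\ m iz = 0%N.
  move=> mf /eqP wm; case: (shape_z fy mf) => [E|mz].
    by exfalso; move: wm; rewrite E wtU; have := mul_gt1_lt e1R muy yz; lra.
  split=> //; apply/eqP; rewrite -(eqr_nat R); apply/eqP.
  by move: wm; rewrite wt3E x0 mz; nra.
have -> : V r.+1 iy = (L \Po V r ix) * V r iy ^+ e.
  rewrite /V top_orbitS /L raddf_sum mulr_suml /= big_seq_cond [RHS]big_seq_cond.
  apply: eq_bigr => m /andP[mf wm]; have [my mz] := top_iy m mf wm.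
  rewrite linearZ /= rmorphXn /= comp_polyX mmap1_3 my mz expr0 mulr1.
  by rewrite -mul_polyC mulrA.
rewrite mulf_neq0 ?expf_neq0 // comp_poly_eq0 ?Vx //.
have [ms msf wms] := ex iy; have [msy msz] := top_iy ms msf (introT eqP wms).
(* Top monomials of f_y differ in their exponents of x, so no two of them merge in [L]. *)
suff : L`_(ms ix) = (tnth f iy)@_ms.
  by move=> Lms; apply/eqP => L0; move: msf; rewrite mcoeff_msupp -Lms L0 coef0 eqxx.
rewrite /L coef_sum -big_filter (bigD1_seq ms) ?filter_uniq ?msupp_uniq //=; last first.
  by rewrite mem_filter msf wms eqxx.
rewrite coefZ coefXn eqxx mulr1 big_seq_cond big1 ?addr0 // => m /andP[].
rewrite mem_filter => /andP[wm mf] mms; have [my mz] := top_iy m mf wm.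
rewrite coefZ coefXn; case: eqP => [e_ix|_]; last by rewrite mulr0.
by case/eqP: mms; apply: mnm3P; rewrite ?my ?mz.
Qed.

End TameCases.

Section TameCycles.
Variables (R : realType) (k : fieldType).
Implicit Types (f : endo k 3) (m : 'X_{1..3}).

(** With weights (th, d, 1), where [d] is the degree of f_y in x, a monomial x^i y^j of f_x requires
    i th + j d <= th^2; [S] lists the pairs (i, j d). The dependence of f_y on x makes [d] positive.
    When [th > 1], these weights are the only maximal eigenvector up to scaling. *)
Lemma tame_swap_xz f : shape_at iz (tnth f ix) -> shape_at iy (tnth f iy) ->
  shape_at ix (tnth f iz) ->
  (exists2 m, m \in msupp (tnth f iy) & m ix != 0%N) -> exists th : R, tame f th.
Proof.
move=> fx fy fz [m1 m1f m1x]; have [d [dmax dex]] := exponent_max R (tnth f iy) ix.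
have d0 : (0 < d)%N by apply: leq_trans (dmax _ m1f); rewrite lt0n.
have d0R : 1 <= d%:R :> R by rewrite ler1n.
have [md mdf mdx] := dex (lt0n_neq0 d0).
have [mdy mdz] : md iy = 0%N /\ md iz = 0%N.
  by case: (shape_y fy mdf) => // e; move: d0; rewrite -mdx e mnm1E.
pose S := [seq (m ix, (m iy * d)%N) | m : 'X_{1..3} <- msupp (tnth f ix) & m iz == 0%N].
have [th [th1 thS thE]] := threshold S (lexx (1 : R)).
have low m : m \in msupp (tnth f ix) -> m iz = 0%N -> (m ix, (m iy * d)%N) \in S.
  by move=> mf mz; apply/mapP; exists m; rewrite // mem_filter mz mf.
have up (eta : R) : th <= eta -> forall i, wle (vec3 eta d%:R 1) (eta * vec3 eta d%:R 1 i) (tnth f i).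
  move=> eta_th; have eta1 := le_trans th1 eta_th.
  apply: ord3P; rewrite {2}/vec3 /=.
  - apply: wle_shape_z => // [|m mf mz]; rewrite /vec3 /=; first by nra.
    have /= := thS _ (low m mf mz).
    by move/(threshold_mono th1 eta_th); rewrite natrM expr2.
  - apply: wle_shape_y => // [|m mf my mz]; rewrite /vec3 /=; first by nra.
    have : (m ix)%:R <= d%:R :> R by rewrite ler_nat dmax.
    by nra.
  - by apply: wle_shape_x => //; rewrite /vec3 /=; lra.
exists th; split=> //.
- case: thE => [->|[ab _ e]]; first by exists 0%N, 1%N; lra.
  by exists ab.1, ab.2.
- move=> eta eta_th; exists (vec3 eta d%:R 1); last exact: up (ltW eta_th).
  by apply: ord3P; rewrite /vec3 /=; lra.
have [->|thn1] := eqVneq th 1; [by left|right].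
have {}th1 : 1 < th by rewrite lt_neqAle eq_sym thn1 th1.
have th0 := lt_trans ltr01 th1.
split=> [|mu mu_eigen [i mui]].
  exists (vec3 th d%:R 1); last by exists iz; rewrite /vec3 /= oner_neq0.
  split=> [||]; last 1 first; [|by apply: ord3P; rewrite /vec3 /=; lra|exact: up].
  apply: ord3P; rewrite {2}/vec3 /=.
  - case: thE => [e|[_ /mapP[m + ->]]]; first by rewrite e eqxx in thn1.
    rewrite mem_filter => /andP[/eqP mz mf] /= e; exists m => //.
    by move: e; rewrite wt3E /vec3 /= mz natrM expr2 => ->; lra.
  - by exists md => //; rewrite wt3E mdx mdy mdz /vec3 /=; lra.
  - by exists U_(ix)%MM; [case: fz|rewrite wtU /vec3 /=; lra].
have xz := eigen_shape_x th0 fz mu_eigen.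
have [mu0 le ex] := mu_eigen.
have dxy : d%:R * mu ix <= th * mu iy.
  by have := le _ _ mdf; rewrite wt3E mdx mdy mdz !mul0r !addr0.
have mux : 0 < mu ix.
  rewrite lt_neqAle mu0 andbT eq_sym; apply: contra mui => /eqP x0.
  have z0 : mu iz = 0 by nra.
  have y0 : mu iy = 0.
    have [m mf] := ex iy; rewrite wt3E x0 z0; case: (shape_y fy mf) => [->|[-> _]].
      by rewrite !mnm1E /=; nra.
    by nra.
  by apply/eqP; move: i; apply: ord3P.
have muy : 0 < mu iy by nra.
have top_iy m : m \in msupp (tnth f iy) -> wt mu m = th * mu iy ->
    [/\ m iy = 0%N, m iz = 0%N & (m ix)%:R * mu ix = th * mu iy].
  move=> mf wm; case: (shape_y fy mf) => [e|[my mz]].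
    by exfalso; move: wm; rewrite e wtU; nra.
  by split=> //; move: wm; rewrite wt3E my mz !mul0r !addr0.
have exy : d%:R * mu ix = th * mu iy.
  have [m mf wm] := ex iy; have [my mz wm'] := top_iy m mf wm.
  have : (m ix)%:R <= d%:R :> R by rewrite ler_nat dmax.
  by nra.
have wmd : wt mu md = th * mu iy by rewrite wt3E mdx mdy mdz; lra.
have top_ix m : m \in msupp (tnth f ix) -> wt mu m = th * mu ix -> m iz = 0%N.
  move=> mf wm; case: (shape_z fx mf) => [e|//].
  by have := mul_gt1_lt th1 mux xz; rewrite -wm e wtU ltxx.
(* The top part of f_y is a multiple of x^d. If y occurs in that of f_x, the map of the (x, y)-plane
   is dominant; otherwise the top part of f_x is a power of x. *)
have [[mt mtf [wmt mty]]|no] := pselect (exists2 m, m \in msupp (tnth f ix) &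
    wt mu m = th * mu ix /\ m iy != 0%N).
  apply: (@dominant_top_survives _ _ _ f th mu th0 le ix iy md) => //.
  - by move=> m mf wm; apply: ord3P => //; rewrite (top_ix m).
  - by exists mt.
  - by rewrite mdx -lt0n.
  - by apply: ord3P.
  - move=> m mf wm; have [my mz wm'] := top_iy m mf wm.
    apply: mnm3P; rewrite ?my ?mz // mdx; apply/eqP; rewrite -(eqr_nat R); apply/eqP.
    by apply: (@mulIf _ (mu ix)); [rewrite gt_eqF|rewrite wm' exy].
have {}no m : m \in msupp (tnth f ix) -> wt mu m = th * mu ix -> m iy = 0%N.
  by move=> mf wm; apply/eqP; apply/negPn/negP => my; apply: no; exists m.
have [m0 m0f wm0] := ex ix.
apply: (@monomial_top_survives _ _ _ f th mu th0 le pred0 ix m0) => //.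
- apply: ord3P => // _; [exact: no wm0|exact: top_ix wm0].
- move=> m mf wm; left; apply: mnm3P; rewrite ?(no m) ?(no m0) ?(top_ix m) ?(top_ix m0) //.
  apply/eqP; rewrite -(eqr_nat R); apply/eqP; apply: (@mulIf _ (mu ix)); first by rewrite gt_eqF.
  have := wm; rewrite -wm0 !wt3E (no m) // (no m0) // (top_ix m) // (top_ix m0) //; lra.
Qed.

(* In the excluded configuration the top part of [f_y] may be a multiple of the [d]-th
   power of the top part of [f_x], and then the second iterate of the top part of [f]
   can vanish. *)
Lemma tame_cycle f : shape_at iy (tnth f ix) -> shape_at iz (tnth f iy) ->
  shape_at ix (tnth f iz) ->
  ~ (exists d : nat, [/\ (1 < d)%N,
      forall m, m \in msupp (tnth f ix) -> (m ix <= d)%N,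
      exists2 m, m \in msupp (tnth f ix) & m ix = d,
      exists2 m, m \in msupp (tnth f iy) & [/\ m ix = (d * d)%N, m iy = 0%N & m iz = 0%N] &
      forall m, m \in msupp (tnth f iy) -> m iz = 0%N -> (m ix + m iy * d <= d * d)%N]) ->
  exists th : R, tame f th.
Proof.
move=> fx fy fz not_bad; have [d [dmax dex]] := exponent_max R (tnth f ix) ix.
(* For weights (eta, eta^2, 1), f_x requires [d <= eta], and a monomial x^i y^j of f_y requires i
   eta + j eta^2 <= eta^3, that is j eta + i <= eta^2. This gives [t] and the pairs in [S]. *)
pose t : R := Num.max 1 d%:R.
have t1 : 1 <= t by rewrite le_max lexx.
have td : d%:R <= t by rewrite le_max lexx orbT.
pose S := [seq (m iy, m ix) | m : 'X_{1..3} <- msupp (tnth f iy) & m iz == 0%N].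
have [th [tth thS thE]] := threshold S t1.
have th1 := le_trans t1 tth; have dth := le_trans td tth.
have low m : m \in msupp (tnth f iy) -> m iz = 0%N -> (m iy, m ix) \in S.
  by move=> mf mz; apply/mapP; exists m; rewrite // mem_filter mz mf.
have dmaxR m : m \in msupp (tnth f ix) -> (m ix)%:R <= d%:R :> R.
  by move=> mf; rewrite ler_nat dmax.
have up (eta : R) : th <= eta ->
    forall i, wle (vec3 eta (eta ^+ 2) 1) (eta * vec3 eta (eta ^+ 2) 1 i) (tnth f i).
  move=> eta_th; have eta1 := le_trans th1 eta_th; have etad := le_trans dth eta_th.
  apply: ord3P; rewrite {2}/vec3 /=.
  - apply: wle_shape_y => // m mf my mz; rewrite /vec3 /=.
    by have := dmaxR _ mf; nra.
  - apply: wle_shape_z => // [|m mf mz]; rewrite /vec3 /=.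
      by rewrite -exprS exprn_ege1.
    have /= := thS _ (low m mf mz).
    by move/(threshold_mono th1 eta_th); nra.
  - by apply: wle_shape_x => //; rewrite /vec3 /=; lra.
exists th; split=> //.
- case: thE => [->|[ab _ e]]; last by exists ab.1, ab.2.
  rewrite /t; case: (leP 1 (d%:R : R)) => _; first by exists d, 0%N; rewrite addr0 expr2.
  by exists 0%N, 1%N; lra.
- move=> eta eta_th; exists (vec3 eta (eta ^+ 2) 1); last exact: up (ltW eta_th).
  have eta0 : 0 < eta by lra.
  by apply: ord3P; rewrite /vec3 /= ?exprn_gt0.
have [->|thn1] := eqVneq th 1; [by left|right].
have {}th1 : 1 < th by rewrite lt_neqAle eq_sym thn1 th1.
have th0 := lt_trans ltr01 th1.
split=> [|mu mu_eigen [i mui]].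
  (* If some monomial of f_y turns its inequality into an equality, (th, th^2, 1) is an eigenvector.
     Otherwise [th = d], x^d carries f_x, and the weight of y is lowered until f_y attains its
     bound. *)
  have [[m mf [mz e]]|no_eq] := pselect (exists2 m, m \in msupp (tnth f iy) &
      m iz = 0%N /\ th ^+ 2 = (m iy)%:R * th + (m ix)%:R).
    exists (vec3 th (th ^+ 2) 1); last by exists iz; rewrite /vec3 /= oner_neq0.
    split=> [||]; last 1 first; [|by apply: ord3P; rewrite /vec3 /= ?exprn_ge0; lra|exact: up].
    apply: ord3P; rewrite {2}/vec3 /=.
    - by exists U_(iy)%MM; [case: fx|rewrite wtU /vec3 /=; lra].
    - by exists m => //; rewrite wt3E /vec3 /= mz {2}e; ring.
    - by exists U_(ix)%MM; [case: fz|rewrite wtU /vec3 /=; lra].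
  have {}thE : th = d%:R.
    case: thE => [th_t|[_ /mapP[m + ->] /= e]]; last first.
      rewrite mem_filter => /andP[/eqP mz mf].
      by case: no_eq; exists m.
    by move: th1; rewrite th_t /t; case: (leP 1 (d%:R : R)); rewrite ?ltxx.
  have strict m : m \in msupp (tnth f iy) -> m iz = 0%N ->
      (m iy)%:R * th + (m ix)%:R < th ^+ 2.
    move=> mf mz; rewrite lt_neqAle (thS _ (low m mf mz)) andbT.
    by apply/eqP => e; apply: no_eq; exists m.
  have y_lt m : m \in msupp (tnth f iy) -> (m iy)%:R < th.
    move=> mf; case: (shape_z fy mf) => [->|mz]; first by rewrite mnm1E.
    have := strict m mf mz; have : 0 <= (m ix)%:R :> R by [].
    by nra.
  (* [F m] is the weight w of y that makes x^i y^j z^l exact in f_y when x has weight th and z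
     weight 1: th w = i th + j w + l. The largest such w suits all monomials. *)
  pose F m : R := ((m ix)%:R * th + (m iz)%:R) / (th - (m iy)%:R).
  have [m0 m0f m0max] := seq_max F (proj1 fy).
  have FE m : m \in msupp (tnth f iy) ->
      F m * (th - (m iy)%:R) = (m ix)%:R * th + (m iz)%:R.
    by move=> mf; rewrite /F divfK // gt_eqF // subr_gt0 y_lt.
  have F0 : 0 <= F m0.
    by rewrite divr_ge0 ?subr_ge0 ?(ltW (y_lt _ m0f)) // addr_ge0 ?mulr_ge0 // ltW.
  have F_le : F m0 <= th ^+ 2.
    have := FE _ m0f; have := y_lt _ m0f; case: (shape_z fy m0f) => [->|m0z].
      by rewrite !mnm1E /=; nra.
    rewrite m0z; have := strict _ m0f m0z; set i0 := (m0 ix)%:R; set j0 := (m0 iy)%:R => s1 s2 s3.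
    have : F m0 * (th - j0) <= th ^+ 2 * (th - j0) by nra.
    by rewrite ler_pM2r // subr_gt0.
  exists (vec3 th (F m0) 1); last by exists iz; rewrite /vec3 /= oner_neq0.
  split=> [||].
  - by apply: ord3P; rewrite /vec3 /=; lra.
  - apply: ord3P; rewrite {2}/vec3 /=.
    + apply: wle_shape_y => // m mf my mz; rewrite /vec3 /=.
      by have := dmaxR _ mf; nra.
    + move=> m mf; rewrite wt3E /vec3 /=; have := m0max _ mf; have := FE _ mf.
      have := y_lt _ mf; set j0 := (m iy)%:R => s1 s2 s3.
      have : F m * (th - j0) <= F m0 * (th - j0) by rewrite ler_wpM2r // subr_ge0 ltW.
      by rewrite s2; lra.
    + by apply: wle_shape_x => //; rewrite /vec3 /=; lra.
  - apply: ord3P; rewrite {2}/vec3 /=.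
    + have d1 : (0 < d)%N by rewrite -(ltr_nat R) -thE.
      have [md mdf mdx] := dex (lt0n_neq0 d1); exists md => //.
      have [mdy mdz] : md iy = 0%N /\ md iz = 0%N.
        by case: (shape_y fx mdf) => // e; move: d1; rewrite -mdx e mnm1E.
      by rewrite wt3E mdx mdy mdz /vec3 /= -thE; lra.
    + by exists m0 => //; rewrite wt3E /vec3 /=; have := FE _ m0f; lra.
    + by exists U_(ix)%MM; [case: fz|rewrite wtU /vec3 /=; lra].
have xz := eigen_shape_x th0 fz mu_eigen.
have [mu0 le ex] := mu_eigen.
have y_le : mu iy <= th * mu ix by have [/le] := fx; rewrite wtU.
have mux : 0 < mu ix.
  rewrite lt_neqAle mu0 andbT eq_sym; apply: contra mui => /eqP x0.
  have z0 : mu iz = 0 by nra.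
  have y0 : mu iy = 0 by have := mu0 iy; nra.
  by apply/eqP; move: i; apply: ord3P.
have z_lt := mul_gt1_lt th1 mux xz.
have low_ix m : m iy = 0%N -> m iz = 0%N -> wt mu m = th * mu ix -> (m ix)%:R = th.
  by move=> my mz; rewrite wt3E my mz => wm; apply: (@mulIf _ (mu ix)); [rewrite gt_eqF|lra].
(* If y is lighter than [th * mu ix], the top part of f_x is a power of x. *)
have [y_eq|y_neq] := eqVneq (mu iy) (th * mu ix); last first.
  have top_ix m : m \in msupp (tnth f ix) -> wt mu m = th * mu ix ->
      [/\ m iy = 0%N, m iz = 0%N & (m ix)%:R = th].
    move=> mf wm; case: (shape_y fx mf) => [e|[my mz]].
      by move: wm; rewrite e wtU => e'; rewrite e' eqxx in y_neq.
    by split=> //; apply: low_ix.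
  have [md mdf wmd] := ex ix; have [mdy mdz mdx] := top_ix _ mdf wmd.
  apply: (@monomial_top_survives _ _ _ f th mu th0 le pred0 ix md) => //.
    by apply: ord3P.
  move=> m mf wm; left; have [my mz mx] := top_ix _ mf wm.
  by apply: mnm3P; rewrite ?my ?mz //; apply/eqP; rewrite -(eqr_nat R) mx mdx.
have muy : 0 < mu iy by nra.
have top_iy m : m \in msupp (tnth f iy) -> wt mu m = th * mu iy -> m iz = 0%N.
  move=> mf wm; case: (shape_z fy mf) => [e|//]; exfalso.
  by move: wm; rewrite e wtU y_eq; nra.
(* Now y is on top in f_x, possibly together with x^d. In that case setting y = 0 leaves x^d,
   provided the top part of f_y is divisible by y. *)
have [[md mdf [mdy mdz mdx]]|no] := pselect (exists2 m, m \in msupp (tnth f ix) &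
    [/\ m iy = 0%N, m iz = 0%N & (m ix)%:R = th]).
  have thd : th = d%:R by apply/eqP; rewrite eq_le dth andbT -mdx ler_nat dmax.
  have mdd : md ix = d by apply/eqP; rewrite -(eqr_nat R) mdx thd.
  have d1 : (1 < d)%N by rewrite -(ltr_nat R) -thd.
  apply: (@monomial_top_survives _ _ _ f th mu th0 le (pred1 iy) ix md) => //.
  - by rewrite wt3E mdx mdy mdz; lra.
  - by apply: ord3P.
  - move=> m mf wm; case: (shape_y fx mf) => [->|[my mz]].
      by right; exists iy; rewrite //= mnm1E.
    left; apply: mnm3P; rewrite ?my ?mz //.
    by apply/eqP; rewrite -(eqr_nat R) (low_ix m) // mdx.
  (* A top monomial of f_y without y would be x^(d d), and the bound on the weights of f_y would
     complete the excluded configuration. *)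
  - move=> j /eqP-> m mf wm; exists iy; rewrite //=; apply/eqP => my.
    have mz := top_iy m mf wm.
    apply: not_bad; exists d; split=> //; first by exists md.
      exists m => //; split=> //; apply/eqP; rewrite -(eqr_nat R); apply/eqP.
      apply: (@mulIf _ (mu ix)); first by rewrite gt_eqF.
      by move: wm; rewrite wt3E my mz y_eq natrM -thd; lra.
    move=> m' m'f m'z; have := le _ _ m'f; rewrite wt3E m'z y_eq thd.
    by rewrite -(ler_nat R) natrD !natrM -(ler_pM2r mux); lra.
have top_ix m : m \in msupp (tnth f ix) -> wt mu m = th * mu ix -> m = U_(iy)%MM.
  move=> mf wm; case: (shape_y fx mf) => [//|[my mz]].
  by case: no; exists m => //; split=> //; apply: low_ix.
(* The top part of f_x is a multiple of y. If x occurs in that of f_y, the plane map is dominant;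
   otherwise the top part of f_y is a power of y. *)
have [[mt mtf [wmt mtx]]|no'] := pselect (exists2 m, m \in msupp (tnth f iy) &
    wt mu m = th * mu iy /\ m ix != 0%N).
  apply: (@dominant_top_survives _ _ _ f th mu th0 le iy ix U_(iy)%MM) => //.
  - by move=> m mf wm; apply: ord3P => //; rewrite (top_iy m).
  - by exists mt.
  - by case: fx.
  - by rewrite wtU.
  - by rewrite mnm1E.
  - by apply: ord3P; rewrite // mnm1E.
have {}no' m : m \in msupp (tnth f iy) -> wt mu m = th * mu iy -> m ix = 0%N.
  by move=> mf wm; apply/eqP; apply/negPn/negP => mx; apply: no'; exists m.
have [m0 m0f wm0] := ex iy.
apply: (@monomial_top_survives _ _ _ f th mu th0 le pred0 iy m0) => //.
- apply: ord3P => // _; [exact: no' wm0|exact: top_iy wm0].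
- move=> m mf wm; left.
  apply: mnm3P; rewrite ?(no' m) ?(no' m0) ?(top_iy m) ?(top_iy m0) //.
  apply/eqP; rewrite -(eqr_nat R); apply/eqP; apply: (@mulIf _ (mu iy)); first by rewrite gt_eqF.
  have := wm; rewrite -wm0 !wt3E (no' m) // (no' m0) // (top_iy m) // (top_iy m0) //; lra.
Qed.

End TameCycles.

(** * Triangular automorphisms and Bruhat decomposition *)

Section Triangular.
Variables (k : fieldType) (n : nat).
Implicit Types (f g t a : endo k n) (p q : {mpoly k[n]}) (i j l : 'I_n).

(** Absence of variables is weight at most 0 for indicator weights, so the rules for [wle] apply to
    [below]. *)
Lemma belowP (b : nat) p : below b p <-> wle (fun j : 'I_n => (b <= j)%N%:R : rat) 0 p.
Proof.
split=> [pb m mp|pb m /pb le j bj].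
  rewrite /wt big1 // => j _; case: leqP => [bj|_]; last by rewrite mulr0.
  by rewrite (pb m mp) // mul0r.
apply/eqP; rewrite -leqn0 -(ler_nat rat); apply: le_trans le.
rewrite /wt (bigD1 j) //= bj mulr1 lerDl sumr_ge0 // => j' _; rewrite mulr_ge0.
Qed.

Lemma below_le (b b' : nat) p : (b <= b')%N -> below b p -> below b' p.
Proof. by move=> bb' pb m mp j /(leq_trans bb'); apply: pb. Qed.

Lemma belowD b p q : below b p -> below b q -> below b (p + q).
Proof. by move=> /belowP pb /belowP qb; apply/belowP; apply: wleD. Qed.

Lemma belowB b p q : below b p -> below b q -> below b (p - q).
Proof. by move=> /belowP pb /belowP qb; apply/belowP; apply: wleB. Qed.

Lemma belowZ b c p : below b p -> below b (c *: p).
Proof. by move=> /belowP pb; apply/belowP; apply: wleZ. Qed.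

Lemma below0 b : below b (0 : {mpoly k[n]}).
Proof. by move=> m; rewrite msupp0. Qed.

Lemma belowX b i : (i < b)%N -> below b ('X_i : {mpoly k[n]}).
Proof.
move=> ib m; rewrite msuppX inE => /eqP-> j bj; rewrite mnm1E.
by case: eqP bj => // <-; rewrite leqNgt ib.
Qed.

Lemma below_comp b b' p g : below b p ->
  (forall j, (j < b)%N -> below b' (tnth g j)) -> below b' (p \mPo g).
Proof.
move=> pb gb; apply/belowP; apply: (@wle_comp _ _ _ _ (fun=> 0)) => [m _|j m mp mj].
  by rewrite wt_const mulr0.
apply/belowP/gb; rewrite ltnNge; apply/negP => /(pb m mp) mj0.
by rewrite mj0 in mj.
Qed.

Lemma is_triangularP t : is_triangular t <-> forall i, below i.+1 (tnth t i).
Proof. by split=> [H i m mt j|H i m mt j]; [apply: H mt j|apply: (H i m mt j)]. Qed.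

Lemma shape_at_addX i c p : c != 0 -> below i p -> shape_at i (c *: 'X_i + p).
Proof.
move=> c0 pi; have pU : p@_U_(i) = 0.
  apply: memN_msupp_eq0; apply/negP => /pi/(_ i (leqnn i)).
  by rewrite mnm1E eqxx.
split; first by rewrite mcoeff_msupp mcoeffD mcoeffZ mcoeffX eqxx mulr1 pU addr0.
move=> m /msuppD_le; rewrite mem_cat => /orP[/msuppZ_le|/pi]; last by right.
by rewrite msuppX inE => /eqP; left.
Qed.

Lemma mmap_polyC_X p :
  mmap (polyC \o @mpolyC n k : {rmorphism k -> {poly {mpoly k[n]}}})
    (fun j => ('X_j)%:P) p = p%:P.
Proof.
rewrite [in LHS](mpolyE p) [in RHS](mpolyE p) !raddf_sum; apply: eq_bigr => m _.
rewrite /= mmapZ mmapX -mul_mpolyC polyCM [in RHS]mpolyXE_id rmorph_prod /mmap1 /=.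
by congr (_ * _); apply: eq_bigr => j _; rewrite rmorphXn.
Qed.

(* Replacing ['X_i] by a fresh variable, [t_i o psi = 'X_i] becomes a composition of
   univariate polynomials equal to the variable, so both factors have degree 1. *)
Lemma triangular_inverse_step t psi i : endo_comp t psi = endo_id k n ->
  endo_comp psi t = endo_id k n -> below i.+1 (tnth t i) ->
  (forall j, (j < i)%N -> below j.+1 (tnth psi j)) ->
  (exists c p, [/\ c != 0, below i p & tnth t i = c *: 'X_i + p]) /\
  below i.+1 (tnth psi i).
Proof.
move=> tpsi psit ti psij.
pose h : {rmorphism k -> {poly {mpoly k[n]}}} := polyC \o @mpolyC n k.
(* [T] is t_i with every earlier psi_j substituted and its own variable kept as X; [P] is psi_i as a
   polynomial in its i-th variable X. *)
pose v j : {poly {mpoly k[n]}} := if j == i then 'X else ('X_j)%:P.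
pose w j : {poly {mpoly k[n]}} := if j == i then 'X else (tnth psi j)%:P.
pose T := mmap h w (tnth t i); pose P := mmap h v (tnth psi i).
have t_supp (m : 'X_{1..n}) j : m \in msupp (tnth t i) -> m j != 0%N -> (j <= i)%N.
  by move=> mt; apply: contraR; rewrite -ltnNge => /(ti m mt) ->.
have compE : T \Po P = 'X.
  transitivity (mmap h v (tnth t i \mPo psi)); last first.
    by rewrite -tnth_endo_comp tpsi tnth_endo_id mmapX mmap1U /v eqxx.
  rewrite mmap_comp (mmap_rmorph (h' := h) (g := comp_poly P)) => [|c]; last first.
    by rewrite /h /= comp_polyC.
  apply: eq_mmap => m j mt mj; rewrite /w.
  have [->|ji] := eqVneq j i; first by rewrite /= comp_polyX.
  rewrite /= comp_polyC -[LHS]mmap_polyC_X; apply: eq_mmap => m' l m'psi m'l.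
  rewrite /v; case: eqP => // li; move: m'l; rewrite li (psij j) ?eqxx //.
    by rewrite ltn_neqAle ji (t_supp m).
  by rewrite ltn_neqAle ji (t_supp m).
have /eqP : (size (T \Po P)).-1 = 1%N by rewrite compE size_polyX.
rewrite size_comp_poly muln_eq1 => /andP[/eqP sT /eqP sP].
have {}sT : size T = 2 by case: (size T) sT => // s /= ->.
have {}sP : size P = 2 by case: (size P) sP => // s /= ->.
have TE : T = (T`_0)%:P + T`_1 *: 'X.
  apply/polyP => -[|[|e]]; rewrite coefD coefC coefZ coefX /= ?mulr0 ?mulr1 ?addr0 ?add0r //.
  by rewrite nth_default // sT.
(* The leading coefficients are mutually inverse polynomials, hence constants. *)
have : T`_1 * P`_1 = 1.
  have /polyP/(_ 1%N) : ((T`_0)%:P + T`_1 *: 'X) \Po P = 'X by rewrite -TE.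
  rewrite comp_polyD comp_polyC comp_polyZ comp_polyX.
  by rewrite coefD coefC coefZ coefX /= add0r.
rewrite mulrC => /mpoly_intro_unit /andP[/eqP T1E _].
set c := (T`_1)@_0%MM in T1E.
have c0 : c != 0.
  apply/eqP => c0; move: sT; rewrite TE T1E c0 mpolyC0 scale0r addr0 => sT.
  by have := size_polyC_leq1 (T`_0); rewrite sT.
pose zi : endo k n := [tuple if j == i then 0 else 'X_j | j < n].
pose p := tnth t i \mPo zi.
have pE : p = T`_0 \mPo t.
  rewrite -horner_coef0 -[T.[0]]/(horner_eval 0 T) /T.
  rewrite (mmap_rmorph (h' := @mpolyC n k)) => [|d]; last by rewrite /= /horner_eval hornerC.
  rewrite (mmap_rmorph (h' := @mpolyC n k) (g := comp_mpoly t)) => [|d]; last first.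
    by rewrite /= comp_mpolyC.
  apply: eq_mmap => m j _ _; rewrite tnth_mktuple /w /= /horner_eval.
  case: eqP => [_|_]; first by rewrite hornerX comp_mpoly0.
  by rewrite hornerC -tnth_endo_comp psit tnth_endo_id.
(* [Th] undoes the substitution: it composes the coefficients with t, which turns psi_j into x_j,
   and sends X to x_i. So [T] goes back to t_i. *)
pose Th : {rmorphism {poly {mpoly k[n]}} -> {mpoly k[n]}} :=
  horner_eval 'X_i \o map_poly (comp_mpoly t).
have ThC q : Th q%:P = q \mPo t by rewrite /Th /= map_polyC /= /horner_eval hornerC.
have ThX : Th 'X = 'X_i by rewrite /Th /= map_polyX /horner_eval hornerX.
have tE : tnth t i = c *: 'X_i + p.
  transitivity (Th T); last first.
    rewrite TE T1E -mul_polyC (rmorphD Th) (rmorphM Th) !ThC ThX comp_mpolyC -pE.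
    by rewrite mul_mpolyC addrC.
  rewrite (mmap_rmorph (h' := @mpolyC n k) (g := Th)) => [|d]; last by rewrite ThC comp_mpolyC.
  rewrite -{1}[tnth t i]comp_mpoly_id; apply: eq_mmap => m j _ _.
  rewrite tnth_mktuple /w; case: eqP => [->|_]; first by rewrite ThX.
  by rewrite ThC -tnth_endo_comp psit tnth_endo_id.
have pi : below i p.
  apply: below_comp ti _ => j; rewrite ltnS tnth_mktuple => ji.
  case: eqP => [_|/eqP ji']; first exact: below0.
  by apply: belowX; rewrite ltn_neqAle ji' ji.
split; first by exists c, p.
have : 'X_i = c *: tnth psi i + (p \mPo psi).
  rewrite -(tnth_endo_id k) -tpsi tnth_endo_comp {1}tE linearD /= linearZ /=.
  by rewrite comp_mpolyXE.
move/(canLR (addrK _)) => e.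
rewrite -[tnth psi i]scale1r -(mulVf c0) -scalerA -e; apply: belowZ; apply: belowB.
  exact: belowX.
apply: below_comp pi _ => j ji; apply: below_le (psij j ji).
by rewrite ltnW.
Qed.

End Triangular.

Section AffineTriangular.
Variables (k : fieldType) (n : nat).
Implicit Types (f g t a : endo k n) (p q : {mpoly k[n]}) (i j l : 'I_n).

Lemma triangular_inverse t psi : endo_inverse t psi -> is_triangular t ->
  (forall i, exists c p, [/\ c != 0, below i p & tnth t i = c *: 'X_i + p]) /\
  is_triangular psi.
Proof.
move=> [tpsi psit] /is_triangularP t_tri.
have psi_tri : forall (d : nat) i, (i < d)%N -> below i.+1 (tnth psi i).
  elim=> [//|d IH] i; rewrite ltnS => id.
  apply: (proj2 (triangular_inverse_step tpsi psit (t_tri i) _)) => j ji.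
  by apply: IH; apply: leq_trans id.
split=> [i|]; last by apply/is_triangularP => i; apply: (psi_tri n).
apply: (proj1 (triangular_inverse_step tpsi psit (t_tri i) _)) => j _.
exact: (psi_tri n).
Qed.

Definition linear_endo (M : 'M[k]_n) : endo k n := [tuple \sum_j M i j *: 'X_j | i < n].

Lemma linear_endo_comp (M N : 'M[k]_n) :
  endo_comp (linear_endo M) (linear_endo N) = linear_endo (M *m N).
Proof.
apply: eq_from_tnth => i; rewrite tnth_endo_comp !tnth_mktuple linear_sum /=.
under eq_bigr => j _ do
  rewrite linearZ /= comp_mpolyXE tnth_mktuple scaler_sumr.
rewrite exchange_big /=; apply: eq_bigr => l _.
by rewrite mxE scaler_suml; apply: eq_bigr => j _; rewrite scalerA.
Qed.

Lemma linear_endo1 : linear_endo 1%:M = endo_id k n.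
Proof.
apply: eq_from_tnth => i; rewrite tnth_endo_id tnth_mktuple (bigD1 i) //= big1 => [|j ji].
  by rewrite mxE eqxx scale1r addr0.
by rewrite mxE eq_sym (negbTE ji) scale0r.
Qed.

Lemma linear_endo_inverse (M : 'M[k]_n) : M \in unitmx ->
  endo_inverse (linear_endo (invmx M)) (linear_endo M).
Proof. by move=> u; split; rewrite linear_endo_comp ?mulmxV ?mulVmx // linear_endo1. Qed.

Lemma linear_endo_deg (M : 'M[k]_n) : (endo_deg (linear_endo M) <= 1)%N.
Proof.
apply: endo_deg_le => i m; rewrite tnth_mktuple => /msupp_sum_le /flattenP [s].
case/mapP => j _ -> /msuppZ_le.
by rewrite msuppX inE => /eqP ->; rewrite mdeg1.
Qed.

Lemma affineE p : (forall m, m \in msupp p -> (mdeg m <= 1)%N) ->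
  p = (p@_0%MM)%:MP + \sum_j p@_U_(j) *: 'X_j.
Proof.
move=> p1; apply/mpolyP => m; rewrite mcoeffD mcoeffC linear_sum /=.
under eq_bigr => j _ do rewrite mcoeffZ mcoeffX.
have [mp|mp] := boolP (m \in msupp p); last first.
  rewrite (memN_msupp_eq0 mp) big1 => [|j _]; last first.
    by case: eqP => [e|_]; rewrite ?mulr0 // e (memN_msupp_eq0 mp) mul0r.
  by case: eqP => [e|_]; rewrite ?mulr0 ?addr0 // -e (memN_msupp_eq0 mp) mul0r.
have := p1 m mp; rewrite leq_eqVlt => /orP[/mdeg1P [j /eqP->]|].
  rewrite mnm1_eq0 mulr0 add0r (bigD1 j) //= eqxx mulr1 big1 ?addr0 // => l lj.
  by rewrite eq_mnm1 (negbTE lj) mulr0.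
rewrite ltnS leqn0 mdeg_eq0 => /eqP->.
rewrite eqxx mulr1 big1 ?addr0 // => j _.
by rewrite mnm1_eq0 mulr0.
Qed.

(** The index is shifted by one, so that 0 means that there is no linear term. *)
Definition last_var p : nat := \max_(j < n | p@_U_(j) != 0) j.+1.

Lemma last_var_ge p j : p@_U_(j) != 0 -> (j < last_var p)%N.
Proof. by move=> pj; rewrite /last_var (bigD1 j) //= leq_maxl. Qed.

Lemma last_var_attained p : (0 < last_var p)%N ->
  exists j, p@_U_(j) != 0 /\ last_var p = j.+1.
Proof.
rewrite /last_var; elim/big_ind: _ => // [x y IHx IHy|j pj _]; last by exists j.
rewrite /maxn; case: ifP => _; [exact: IHy|exact: IHx].
Qed.

Lemma last_var_le p (b : nat) : (forall j, (b <= j)%N -> p@_U_(j) = 0) -> (last_var p <= b)%N.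
Proof.
move=> pb; apply/bigmax_leqP => j pj; rewrite ltnNge.
by apply: contra pj => /pb ->.
Qed.

Lemma argmin (T : Type) (P : T -> Prop) (F : T -> nat) : (exists x, P x) ->
  exists2 x, P x & forall y, P y -> (F x <= F y)%N.
Proof.
move=> [x0 Px0]; have ex : exists d, `[< exists2 x, P x & F x = d >].
  by exists (F x0); apply/asboolP; exists x0.
have [d /asboolP[x Px <-] dmin] := ex_minnP ex.
by exists x => // y Py; apply: dmin; apply/asboolP; exists y.
Qed.

Definition linear_form (u : 'I_n -> k) : {mpoly k[n]} := \sum_j u j *: 'X_j.

Definition unitriangular_row i (u : 'I_n -> k) := u i = 1 /\ forall j, (i < j)%N -> u j = 0.

Lemma mcoeff_linear_form u i : (linear_form u)@_U_(i) = u i.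
Proof.
rewrite linear_sum (bigD1 i) //= mcoeffZ mcoeffX eqxx mulr1 big1 ?addr0 // => j ji.
by rewrite mcoeffZ mcoeffX eq_mnm1 (negbTE ji) mulr0.
Qed.

(* Choosing each row operation so that the last variable of the resulting row comes as
   early as possible makes these last variables distinct: this is the Bruhat
   decomposition of the linear part of [a]. *)
Lemma pivots a : is_aut a -> (forall i m, m \in msupp (tnth a i) -> (mdeg m <= 1)%N) ->
  exists (u : 'I_n -> 'I_n -> k) (s : 'I_n -> 'I_n), injective s /\
    forall i, [/\ unitriangular_row i (u i),
      last_var (linear_form (u i) \mPo a) = (s i).+1 &
      (linear_form (u i) \mPo a)@_U_(s i) != 0].
Proof.
move=> [b [ab ba]] a1; pose w u := linear_form u \mPo a.
have wE u : w u = \sum_j u j *: tnth a j.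
  by rewrite /w linear_sum; apply: eq_bigr => j _; rewrite linearZ /= comp_mpolyXE.
have w1 u m : m \in msupp (w u) -> (mdeg m <= 1)%N.
  rewrite wE => /msupp_sum_le /flattenP [s /mapP[j _ ->]] /msuppZ_le.
  exact: a1.
have min i : exists u, unitriangular_row i u /\
    forall v, unitriangular_row i v -> (last_var (w u) <= last_var (w v))%N.
  have [|u iu umin] := @argmin _ (unitriangular_row i) (fun u => last_var (w u)).
    exists (fun j => (j == i)%:R); split; first by rewrite eqxx.
    by move=> j ij; case: eqP ij => // ->; rewrite ltnn.
  by exists u.
have [u umin] := choice min.
(* Without a linear term the affine polynomial would be constant; composing with the inverse of [a]
   would make the linear form constant, although its coefficient at [i] is 1. *)
have pos i : (0 < last_var (w (u i)))%N.
  rewrite lt0n; apply/eqP => w0.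
  have wC : w (u i) = ((w (u i))@_0%MM)%:MP.
    rewrite [LHS](affineE (@w1 (u i))) big1 ?addr0 // => j _.
    suff -> : (w (u i))@_U_(j) = 0 by rewrite scale0r.
    by apply/eqP/negPn/negP => /last_var_ge; rewrite w0.
  have := mcoeff_linear_form (u i) i; rewrite -[linear_form _]comp_mpoly_id.
  rewrite -[[tuple _ | _ < _]]/(endo_id k n) -ab -comp_mpolyA -/(w (u i)) wC comp_mpolyC.
  rewrite mcoeffC mnm1_eq0 mulr0; have [[-> _] _] := umin i.
  by move/eqP; rewrite eq_sym oner_eq0.
have [s sP] := choice (fun i => last_var_attained (pos i)).
exists u, s; split=> [|i]; last by have [? ?] := sP i; have [? _] := umin i.
suff lt_neq i i' : (i' < i)%N -> s i != s i'.
  move=> i i' e; apply: val_inj; have [lt|lt|//] := ltngtP i i'.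
    by have := lt_neq _ _ lt; rewrite e eqxx.
  by have := lt_neq _ _ lt; rewrite e eqxx.
move=> i'i; apply/eqP => e; have [wi li] := sP i; have [wi' li'] := sP i'.
(* Subtracting [c] times the earlier row cancels the common last variable and keeps the row
   unitriangular, against the minimality of [u i]. *)
pose c := (w (u i))@_U_(s i) / (w (u i'))@_U_(s i').
pose v j := u i j - c * u i' j.
have vi : unitriangular_row i v.
  have [[ui iu] _] := umin i; have [[_ iu'] _] := umin i'.
  split=> [|j ij]; first by rewrite /v ui iu' // mulr0 subr0.
  by rewrite /v iu // iu' ?mulr0 ?subr0 // (ltn_trans i'i).
have vE : w v = w (u i) - c *: w (u i').
  rewrite !wE scaler_sumr -sumrB; apply: eq_bigr => j _.
  by rewrite scalerBl scalerA.
have : (last_var (w v) <= s i)%N.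
  apply: last_var_le => j; rewrite vE mcoeffB mcoeffZ leq_eqVlt => /orP[/eqP sj|sj].
    have {sj} -> : j = s i by apply: val_inj.
    by rewrite {2}e /c divfK ?subrr.
  have w0 i0 : s i0 = s i -> (w (u i0))@_U_(j) = 0.
    move=> si; apply/eqP/negPn/negP => /last_var_ge.
    by have [_ ->] := sP i0; rewrite si ltnS leqNgt sj.
  by rewrite !w0 // mulr0 subrr.
have := (proj2 (umin i)) v vi; rewrite li => lt1 /(leq_trans lt1).
by rewrite ltnn.
Qed.

(** The polynomial [w] is affine in the variables up to x_j, and among the corresponding components
    of [t] only t_j involves x_j. *)
Lemma shaped_of_pivot (t : endo k n) (w : {mpoly k[n]}) j :
  (forall i, exists c p, [/\ c != 0, below i p & tnth t i = c *: 'X_i + p]) ->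
  (forall m, m \in msupp w -> (mdeg m <= 1)%N) ->
  last_var w = j.+1 -> w@_U_(j) != 0 -> shape_at j (w \mPo t).
Proof.
move=> tE w1 wj wj0; have [c [p [c0 pj tj]]] := tE j.
rewrite (affineE w1) (bigD1 j) //= addrCA !linearD /= linearZ /= comp_mpolyXE tj.
rewrite scalerDr scalerA -addrA; apply: shape_at_addX; first by rewrite mulf_neq0.
apply: belowD; first exact: belowZ.
rewrite comp_mpolyC; apply: belowD.
  by move=> m; rewrite msuppC; case: eqP => // _; rewrite inE => /eqP-> l _; rewrite mnm0E.
rewrite linear_sum /=; elim/big_ind: _ => [|q q'|l lj]; [exact: below0|exact: belowD|].
have [wl|wl] := eqVneq w@_U_(l) 0; first by rewrite wl scale0r comp_mpoly0; apply: below0.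
have lj' : (l < j)%N by rewrite ltn_neqAle lj -ltnS -wj last_var_ge.
rewrite linearZ /= comp_mpolyXE; apply: belowZ.
have [d [q [_ ql ->]]] := tE l; apply: belowD; last exact: below_le (ltnW lj') ql.
by apply: belowZ; apply: belowX.
Qed.

(** Conjugating f = a t by the unitriangular linear map U gives (U a)(t U^-1): the right factor
    remains triangular, and the rows of U a have distinct last variables. Linear maps do not raise
    the degree. *)
Lemma affine_triangular_conjugate f : is_aut f -> affine_triangular f ->
  exists (s : 'I_n -> 'I_n) f',
    [/\ shaped s f', aut_conjugate f f' & (endo_deg f' <= endo_deg f)%N].
Proof.
move=> f_aut [a [t [[a_aut a1] t_tri fE]]].
have a_le1 i m : m \in msupp (tnth a i) -> (mdeg m <= 1)%N.
  by move/mdeg_le_endo_deg; rewrite a1.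
have [u [s [s_inj us]]] := pivots a_aut a_le1.
pose M := \matrix_(i, j) u i j; have M_unit : M \in unitmx.
  rewrite unitmxE det_trig; last first.
    by apply/is_trig_mxP => i j ij; rewrite mxE; have [[_ ->]] := us i.
  by rewrite big1 ?unitr1 // => i _; rewrite mxE; have [[->]] := us i.
have [MV VM] := linear_endo_inverse M_unit.
set U := linear_endo M in MV VM; set V := linear_endo (invmx M) in MV VM.
have U_tri : is_triangular U.
  move=> i m; rewrite tnth_mktuple => /msupp_sum_le /flattenP [r /mapP[j _ ->]] mj l il.
  move: mj; rewrite mxE; have [ij|ji] := ltnP i j.
    by have [[_ ->] //] := us i; rewrite scale0r msupp0.
  move/msuppZ_le; rewrite msuppX inE => /eqP->; rewrite mnm1E.
  by case: eqP il => // <-; rewrite ltnNge ji.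
have [_ V_tri] := triangular_inverse (conj VM MV) U_tri.
have t_aut : is_aut t.
  have [b [ab ba]] := a_aut; rewrite -[t]endo_1comp -ba -endo_compA -fE.
  by apply: is_aut_comp => //; exists a.
have tV_aut : is_aut (endo_comp t V) by apply: is_aut_comp => //; exists U.
have tV_tri : is_triangular (endo_comp t V).
  apply/is_triangularP => i; rewrite tnth_endo_comp.
  move/is_triangularP: t_tri => /(_ i) ti; apply: below_comp ti _ => j ji.
  by move/is_triangularP: V_tri => /(_ j); apply: below_le.
have [b tVb] := tV_aut; have [tVE _] := triangular_inverse tVb tV_tri.
exists s, (endo_comp U (endo_comp f V)); split.
- split=> // i; rewrite fE -endo_compA endo_compA tnth_endo_comp tnth_endo_comp.
  have [_ lasti pivi] := us i.
  have UE : tnth U i = linear_form (u i).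
    by rewrite tnth_mktuple; apply: eq_bigr => j _; rewrite mxE.
  rewrite UE; apply: shaped_of_pivot => // m.
  rewrite linear_sum /= => /msupp_sum_le /flattenP [r /mapP[j _ ->]].
  by rewrite linearZ /= comp_mpolyXE => /msuppZ_le; apply: a_le1.
- by exists V, U; split.
- apply: leq_trans (endo_deg_comp _ _) _; apply: leq_trans (leq_mul (linear_endo_deg M) (endo_deg_comp _ _)) _.
  rewrite mul1n -[leqRHS]muln1; apply: leq_mul => //; exact: linear_endo_deg.
Qed.

End AffineTriangular.

(** * Conjugations in three variables *)

Section Conjugations.
Variable k : fieldType.
Implicit Types (f g : endo k 3) (p q : {mpoly k[3]}) (m : 'X_{1..3}).

Lemma shape_atE n (j : 'I_n) (p : {mpoly k[n]}) : shape_at j p ->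
  exists c (q : {mpoly k[n]}), [/\ c != 0, below j q & p = c *: 'X_j + q].
Proof.
move=> [pU pj]; exists p@_U_(j), (p - p@_U_(j) *: 'X_j).
split; [by rewrite -mcoeff_msupp| |by rewrite addrC subrK].
move=> m; rewrite mcoeff_msupp mcoeffB mcoeffZ mcoeffX.
have [<-|Um] := eqVneq U_(j)%MM m; first by rewrite mulr1 subrr eqxx.
rewrite mulr0 subr0 -mcoeff_msupp => mp; case: (pj m mp) => // mU.
by rewrite mU eqxx in Um.
Qed.

Lemma msupp_addX n (j : 'I_n) (c : k) (p : {mpoly k[n]}) (m : 'X_{1..n}) : below j p -> m \in msupp p ->
  m \in msupp (c *: 'X_j + p).
Proof.
move=> pj mp; rewrite mcoeff_msupp mcoeffD mcoeffZ mcoeffX.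
have [e|_] := eqVneq U_(j)%MM m; last by rewrite mulr0 add0r -mcoeff_msupp.
by have := pj _ mp j (leqnn j); rewrite -e mnm1E eqxx.
Qed.

Lemma comp_below n (b : nat) (p : {mpoly k[n]}) (g h : endo k n) : below b p ->
  (forall j : 'I_n, (j < b)%N -> tnth g j = tnth h j) -> p \mPo g = p \mPo h.
Proof.
move=> pb gh; apply: eq_mmap => m j mp mj; apply: gh.
by rewrite ltnNge; apply/negP => /(pb m mp) mj0; rewrite mj0 in mj.
Qed.

Lemma comp_below_id n (b : nat) (p : {mpoly k[n]}) (g : endo k n) : below b p ->
  (forall j : 'I_n, (j < b)%N -> tnth g j = 'X_j) -> p \mPo g = p.
Proof.
move=> pb gX; rewrite -[RHS]comp_mpoly_id; apply: comp_below pb _ => j jb.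
by rewrite gX // tnth_mktuple.
Qed.

Definition triple p0 p1 p2 : endo k 3 := [tuple nth 0 [:: p0; p1; p2] i | i < 3].

Lemma tnth_triple p0 p1 p2 (i : 'I_3) : tnth (triple p0 p1 p2) i = nth 0 [:: p0; p1; p2] i.
Proof. exact: tnth_mktuple. Qed.

Lemma endo3P f g : tnth f ix = tnth g ix -> tnth f iy = tnth g iy -> tnth f iz = tnth g iz ->
  f = g.
Proof. by move=> ex ey ez; apply: eq_from_tnth; apply: ord3P. Qed.

Definition ord3_fun (a b c : 'I_3) : 'I_3 -> 'I_3 := fun i => nth ix [:: a; b; c] i.

Lemma shaped3 a b c f : uniq [:: a; b; c] -> shape_at a (tnth f ix) ->
  shape_at b (tnth f iy) -> shape_at c (tnth f iz) -> shaped (ord3_fun a b c) f.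
Proof.
move=> u fx fy fz; split; last by apply: ord3P.
move=> i j /eqP; rewrite /ord3_fun nth_uniq //; first by move/eqP/val_inj.
Qed.

Lemma shaped_deg_gt0 (j i : 'I_3) f : shape_at j (tnth f i) -> (0 < endo_deg f)%N.
Proof. by move=> [/mdeg_le_endo_deg]; rewrite mdeg1. Qed.

Definition swap_xy : endo k 3 := triple 'X_iy 'X_ix 'X_iz.

Lemma swap_xyK : endo_comp swap_xy swap_xy = endo_id k 3.
Proof.
by apply: endo3P; rewrite tnth_endo_comp tnth_endo_id tnth_triple /= comp_mpolyXE tnth_triple.
Qed.

Lemma endo_deg_swap_xy : (endo_deg swap_xy <= 1)%N.
Proof.
apply: endo_deg_le => i m; rewrite tnth_triple.
by move: i; apply: ord3P => /=; rewrite msuppX inE => /eqP->; rewrite mdeg1.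
Qed.

Lemma conj_swap_xy f : let f' := endo_comp swap_xy (endo_comp f swap_xy) in
  [/\ aut_conjugate f f', (endo_deg f' <= endo_deg f)%N,
      tnth f' ix = tnth f iy \mPo swap_xy,
      tnth f' iy = tnth f ix \mPo swap_xy &
      tnth f' iz = tnth f iz \mPo swap_xy].
Proof.
split.
- by exists swap_xy, swap_xy; split=> //; split; apply: swap_xyK.
- apply: leq_trans (endo_deg_comp _ _) _.
  apply: leq_trans (leq_mul endo_deg_swap_xy (endo_deg_comp _ _)) _.
  by rewrite mul1n -[leqRHS]muln1 leq_mul // endo_deg_swap_xy.
- by rewrite tnth_endo_comp tnth_triple /= comp_mpolyXE tnth_endo_comp.
- by rewrite tnth_endo_comp tnth_triple /= comp_mpolyXE tnth_endo_comp.
- by rewrite tnth_endo_comp tnth_triple /= comp_mpolyXE tnth_endo_comp.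
Qed.

(** If f_y is free of x, it depends on y alone; renaming y as the first variable leads to the order
    treated by [tame_swap_yz]. *)
Lemma swap_xz_conjugate f : shape_at iz (tnth f ix) -> shape_at iy (tnth f iy) ->
  shape_at ix (tnth f iz) -> (forall m, m \in msupp (tnth f iy) -> m ix = 0%N) ->
  exists f', [/\ aut_conjugate f f', (endo_deg f' <= endo_deg f)%N,
    shape_at ix (tnth f' ix), shape_at iz (tnth f' iy) & shape_at iy (tnth f' iz)].
Proof.
move=> fx fy fz no_x; have [conj_f deg_f ex ey ez] := conj_swap_xy f.
exists (endo_comp swap_xy (endo_comp f swap_xy)); split=> //; rewrite ?ex ?ey ?ez.
- have [c [q [c0 q1 fyE]]] := shape_atE fy.
  rewrite fyE linearD /= linearZ /= comp_mpolyXE tnth_triple /=.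
  apply: shape_at_addX => //; apply: (@below_comp _ _ 0) => // m mq j _.
  have [->|mj] := eqVneq j ix.
    by apply: no_x; rewrite fyE; apply: msupp_addX.
  by apply: q1 mq _ _; rewrite lt0n.
- have [c [q [c0 q2 ->]]] := shape_atE fx.
  rewrite linearD /= linearZ /= comp_mpolyXE tnth_triple /=.
  apply: shape_at_addX => //; apply: below_comp q2 _; apply: ord3P => // _.
  + by rewrite tnth_triple; apply: belowX.
  + by rewrite tnth_triple; apply: belowX.
- have [c [q [c0 q0 ->]]] := shape_atE fz.
  rewrite linearD /= linearZ /= comp_mpolyXE tnth_triple /=.
  by apply: shape_at_addX => //; apply: below_comp q0 _.
Qed.

(* Replacing [z] by [z - r(y)], where [r o f_y] is the part of [f_z] involving [x],
   makes [f_z] linear; exchanging [x] and [y] then gives the other 3-cycle. *)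
Lemma cycle_conjugate f : shape_at iz (tnth f ix) -> shape_at ix (tnth f iy) ->
  shape_at iy (tnth f iz) ->
  exists f', [/\ aut_conjugate f f', (endo_deg f' <= endo_deg f)%N,
    shape_at iy (tnth f' ix) /\ (forall m, m \in msupp (tnth f' ix) -> m ix = 0%N),
    shape_at iz (tnth f' iy) & shape_at ix (tnth f' iz)].
Proof.
move=> fx fy fz.
have [c [q [c0 q2 fxE]]] := shape_atE fx.
have [a [e [a0 e0 fyE]]] := shape_atE fy.
have [b [p [b0 p1 fzE]]] := shape_atE fz.
have e_comp g : e \mPo g = e by apply: comp_below_id e0 _.
(* Only the first entry of [y'] matters, as [p] involves x alone. Thus r = p(a^-1 (y - e)), which f
   turns into p(x), and r has at most the degree of p. *)
pose y' : endo k 3 := [tuple a^-1 *: ('X_iy - e) | i < 3].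
pose r := p \mPo y'.
pose psi := triple 'X_ix 'X_iy ('X_iz - r); pose phi := triple 'X_ix 'X_iy ('X_iz + r).
have r_comp g : tnth g iy = 'X_iy -> r \mPo g = r.
  move=> gy; rewrite /r comp_mpolyA; congr (_ \mPo _); apply: eq_from_tnth => i.
  by rewrite tnth_endo_comp !tnth_mktuple linearZ /= linearB /= comp_mpolyXE gy e_comp.
have rf : r \mPo f = p.
  rewrite /r comp_mpolyA; apply: comp_below_id p1 _ => j; rewrite ltnS leqn0 => /eqP j0.
  have -> : j = ix by apply: val_inj.
  rewrite tnth_endo_comp tnth_mktuple linearZ /= linearB /= comp_mpolyXE e_comp fyE.
  by rewrite addrK scalerA mulVf // scale1r.
have psi_phi : endo_inverse phi psi.
  split; apply: endo3P; rewrite tnth_endo_comp tnth_endo_id tnth_triple /=;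
    rewrite ?linearB ?linearD /= comp_mpolyXE tnth_triple //= r_comp ?tnth_triple //.
  - by rewrite subrK.
  - by rewrite addrK.
pose g := endo_comp psi (endo_comp f phi).
have gx : tnth g ix = c *: 'X_iz + (c *: r + q).
  rewrite tnth_endo_comp tnth_triple /= comp_mpolyXE tnth_endo_comp fxE linearD linearZ /=.
  rewrite comp_mpolyXE tnth_triple /= scalerDr -addrA; congr (_ + (_ + _)).
  by apply: comp_below_id q2 _; apply: ord3P; rewrite // tnth_triple.
have gy : tnth g iy = a *: 'X_ix + e.
  rewrite tnth_endo_comp tnth_triple /= comp_mpolyXE tnth_endo_comp fyE linearD linearZ /=.
  by rewrite comp_mpolyXE tnth_triple e_comp.
have gz : tnth g iz = b *: 'X_iy.
  rewrite tnth_endo_comp tnth_triple /= linearB /= comp_mpolyXE tnth_endo_comp -comp_mpolyA rf.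
  by rewrite fzE linearD linearZ /= addrK comp_mpolyXE tnth_triple.
have deg_g : (endo_deg g <= endo_deg f)%N.
  have deg_f := shaped_deg_gt0 fx; pose w := (fun=> 1) : 'I_3 -> rat.
  have wX i : wle w (endo_deg f)%:R ('X_i : {mpoly k[3]}).
    by apply: (@wle_trans _ _ _ _ _ _ _ _ (@wle_XU _ _ _ w i)); rewrite ler1n.
  have wf i : wle w (endo_deg f)%:R (tnth f i) by apply: endo_deg_wle.
  have wq : wle w (endo_deg f)%:R q.
    have -> : q = tnth f ix - c *: 'X_iz by rewrite fxE [RHS]addrC addKr.
    by apply: wleB; [exact: wf|apply: wleZ; exact: wX].
  have wp : wle w (endo_deg f)%:R p.
    have -> : p = tnth f iz - b *: 'X_iy by rewrite fzE [RHS]addrC addKr.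
    by apply: wleB; [exact: wf|apply: wleZ; exact: wX].
  apply: (@wle_endo_deg _ _ rat); apply: ord3P.
  - rewrite gx; apply: wleD; first by apply: wleZ; exact: wX.
    apply: wleD; last exact: wq.
    apply: wleZ; apply: (@wle_comp _ _ _ _ w _ _ _ wp) => j m _ _.
    rewrite tnth_mktuple; apply: wleZ; apply: wleB; first exact: wle_XU.
    move=> m' m'e; rewrite wt_const (_ : m' = 0%MM) ?mdeg0 ?mul0r //.
    by apply/mnmP => l; rewrite mnm0E (e0 _ m'e).
  - rewrite gy -fyE; exact: wf.
  - by rewrite gz; apply: wleZ; exact: wX.
have conj_fg : aut_conjugate f g by exists phi, psi.
clearbody g; have [] := conj_swap_xy g; set f' := endo_comp _ _; clearbody f'.
move=> conj_gf' deg_f' ex ey ez; exists f'; rewrite ex ey ez gx gy gz; split.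
- exact: aut_conjugate_trans conj_fg conj_gf'.
- exact: leq_trans deg_f' deg_g.
- rewrite linearD linearZ /= comp_mpolyXE tnth_triple /= e_comp; split.
    by apply: shape_at_addX => //; apply: below_le e0.
  move=> m /msuppD_le; rewrite mem_cat => /orP[/msuppZ_le|/e0 -> //].
  by rewrite msuppX inE => /eqP->; rewrite mnm1E.
- rewrite linearD linearZ /= comp_mpolyXE tnth_triple /=; apply: shape_at_addX => //.
  apply: (@below_comp _ _ 2); last first.
    by apply: ord3P => // _; rewrite tnth_triple; apply: belowX.
  apply: belowD => //; apply: belowZ; apply: below_comp p1 _ => j _.
  rewrite tnth_mktuple; apply: belowZ; apply: belowB; first exact: belowX.
  exact: below_le e0.
- rewrite linearZ /= comp_mpolyXE tnth_triple /= -[_ *: _]addr0.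
  by apply: shape_at_addX => //; apply: below0.
Qed.

(* Taking [f_x] as new coordinate in place of [y] turns the first component into a
   variable. The weights [1, d, d ^ 2] show that this does not raise the degree above
   [d ^ 2], which is at most the degree of [f]. *)
Lemma degenerate_cycle_conjugate f (d : nat) :
  shape_at iy (tnth f ix) -> shape_at iz (tnth f iy) -> shape_at ix (tnth f iz) ->
  (0 < d)%N -> (forall m, m \in msupp (tnth f ix) -> (m ix <= d)%N) ->
  (exists2 m, m \in msupp (tnth f iy) & (m ix = d * d)%N) ->
  (forall m, m \in msupp (tnth f iy) -> m iz = 0%N -> (m ix + m iy * d <= d * d)%N) ->
  exists f', [/\ aut_conjugate f f', (endo_deg f' <= endo_deg f)%N,
    shape_at iy (tnth f' ix) /\ (forall m, m \in msupp (tnth f' ix) -> m ix = 0%N),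
    shape_at iz (tnth f' iy) & shape_at ix (tnth f' iz)].
Proof.
move=> fx fy fz d0 dmax [md mdf mdx] wd.
have [b [p [b0 p1 fxE]]] := shape_atE fx.
have [c [q [c0 q2 fyE]]] := shape_atE fy.
have [a [e [a0 e0 fzE]]] := shape_atE fz.
have e_comp g : e \mPo g = e by apply: comp_below_id e0 _.
pose psi := triple 'X_ix (tnth f ix) 'X_iz.
pose phi := triple 'X_ix (b^-1 *: ('X_iy - p)) 'X_iz.
have p_comp g : tnth g ix = 'X_ix -> p \mPo g = p.
  by move=> gx; apply: comp_below_id p1 _; apply: ord3P.
have fx_phi : tnth f ix \mPo phi = 'X_iy.
  rewrite fxE linearD linearZ /= comp_mpolyXE p_comp ?tnth_triple //=.
  by rewrite scalerA divff // scale1r subrK.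
have phi_psi : endo_inverse phi psi.
  split; apply: endo3P; rewrite tnth_endo_comp tnth_endo_id tnth_triple /=.
  - by rewrite comp_mpolyXE tnth_triple.
  - rewrite linearZ linearB /= comp_mpolyXE tnth_triple /= p_comp ?tnth_triple //.
    by rewrite fxE addrK scalerA mulVf // scale1r.
  - by rewrite comp_mpolyXE tnth_triple.
  - by rewrite comp_mpolyXE tnth_triple.
  - exact: fx_phi.
  - by rewrite comp_mpolyXE tnth_triple.
pose h := endo_comp f phi; pose g := endo_comp psi h.
have hx : tnth h ix = 'X_iy by rewrite tnth_endo_comp.
have gx : tnth g ix = 'X_iy by rewrite tnth_endo_comp tnth_triple /= comp_mpolyXE.
have gy : tnth g iy = (b * c) *: 'X_iz + (b *: (q \mPo phi) + (p \mPo h)).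
  rewrite tnth_endo_comp tnth_triple /= {1}fxE linearD linearZ /= comp_mpolyXE.
  rewrite tnth_endo_comp fyE linearD linearZ /= comp_mpolyXE tnth_triple /=.
  by rewrite scalerDr scalerA addrA.
have gz : tnth g iz = tnth f iz.
  rewrite tnth_endo_comp tnth_triple /= comp_mpolyXE tnth_endo_comp fzE linearD linearZ /=.
  by rewrite comp_mpolyXE tnth_triple e_comp.
have deg_f : (d * d <= endo_deg f)%N.
  apply: leq_trans (mdeg_le_endo_deg mdf); rewrite -mdx mdegE (bigD1 ix) //=.
  exact: leq_addr.
have deg_g : (endo_deg g <= endo_deg f)%N.
  pose w : 'I_3 -> rat := fun i => nth 0 [:: 1; d%:R; (d * d)%N%:R] i.
  have w_X b' p' m' : below 1 p' -> m' \in msupp p' -> wt b' m' = (m' ix)%:R * b' ix :> rat.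
    by move=> p'1 m'p'; rewrite wt3E (p'1 m' _ iy) // (p'1 m' _ iz) // !mul0r !addr0.
  have p_le m : m \in msupp p -> (m ix)%:R <= d%:R :> rat.
    by move=> mp; rewrite ler_nat dmax // fxE; apply: msupp_addX => //; apply: below_le p1.
  have w_q : wle w (d * d)%N%:R q.
    move=> m mq; have mz := q2 m mq iz (leqnn _); rewrite wt3E mz mul0r addr0 mulr1.
    by rewrite -natrM -natrD ler_nat wd // fyE; apply: msupp_addX.
  have w_phi i : wle w (w i) (tnth phi i).
    move: i; apply: ord3P; rewrite tnth_triple; [exact: (@wle_XU _ _ _ w ix)| |exact: (@wle_XU _ _ _ w iz)].
    apply: wleZ; apply: wleB; first exact: (@wle_XU _ _ _ w iy).
    by move=> m mp; rewrite (w_X w p) // mulr1 p_le.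
  apply: endo_deg_le; apply: ord3P => m.
  - rewrite gx msuppX inE => /eqP->; rewrite mdeg1; exact: shaped_deg_gt0 fx.
  (* All weights in [w] are at least 1, so the [w]-weight bounds the degree. In the last summand [h]
     sends x to y, of weight [d], and [p] has degree at most [d]. *)
  - move=> mg; rewrite (leq_trans _ deg_f) // -(ler_nat rat).
    apply: (@le_trans _ _ (wt w m)).
      rewrite -[leLHS]mulr1 -wt_const; apply: wt_le; apply: ord3P; rewrite /w //= ler1n //.
      by rewrite muln_gt0 d0.
    move: m mg; rewrite gy; apply: (_ : wle w (d * d)%N%:R _).
    apply: wleD; first by apply: wleZ; apply: (@wle_XU _ _ _ w iz).
    apply: wleD; first by apply: wleZ; apply: wle_comp w_q _ => j m _ _.
    apply: (@wle_comp _ _ _ _ (fun=> d%:R)) => [m mp|j m mp mj].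
      by rewrite (w_X _ p) // natrM ler_wpM2r // p_le.
    have -> : j = ix.
      move: j mj; apply: ord3P => //; first by rewrite (p1 m mp).
      by rewrite (p1 m mp).
    by rewrite hx; apply: (@wle_XU _ _ _ w iy).
  - by rewrite gz; apply: mdeg_le_endo_deg.
have conj_fg : aut_conjugate f g by exists phi, psi.
clearbody g; exists g; rewrite gx gy gz; split=> //.
- split; first by rewrite -['X_iy]scale1r -[_ *: _]addr0; apply: shape_at_addX; [exact: oner_neq0|exact: below0].
  by move=> m; rewrite msuppX inE => /eqP->; rewrite mnm1E.
- apply: shape_at_addX; first by rewrite mulf_neq0.
  apply: belowD; first (apply: belowZ; apply: below_comp q2 _; apply: ord3P => // _).
  + by rewrite tnth_triple; apply: belowX.
  + rewrite tnth_triple; apply: belowZ; apply: belowB; first exact: belowX.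
    exact: below_le p1.
  + by apply: below_comp p1 _; apply: ord3P => // _; rewrite hx; apply: belowX.
Qed.

End Conjugations.

(** * Choice of the representative and conclusion *)

Lemma tame_representative (R : realType) (k : fieldType) (s : 'I_3 -> 'I_3) (f : endo k 3) :
  shaped s f -> exists (s' : 'I_3 -> 'I_3) (f' : endo k 3),
    [/\ shaped s' f', aut_conjugate f f', (endo_deg f' <= endo_deg f)%N &
      exists th : R, tame f' th].
Proof.
move=> sf; have [s_inj fs] := sf.
have conj_tame s' f' : shaped s' f' -> aut_conjugate f f' -> (endo_deg f' <= endo_deg f)%N ->
    (exists th : R, tame f' th) -> exists (s' : 'I_3 -> 'I_3) (f' : endo k 3),
    [/\ shaped s' f', aut_conjugate f f', (endo_deg f' <= endo_deg f)%N &
      exists th : R, tame f' th] by move=> ? ? ? ?; exists s', f'.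
have stay := conj_tame s f sf (aut_conjugate_refl f) (leqnn _).
have to_cycle : (exists f', [/\ aut_conjugate f f', (endo_deg f' <= endo_deg f)%N,
    shape_at iy (tnth f' ix) /\ (forall m, m \in msupp (tnth f' ix) -> m ix = 0%N),
    shape_at iz (tnth f' iy) & shape_at ix (tnth f' iz)]) ->
    exists (s' : 'I_3 -> 'I_3) (f' : endo k 3),
    [/\ shaped s' f', aut_conjugate f f', (endo_deg f' <= endo_deg f)%N &
      exists th : R, tame f' th].
  move=> [f' [ff' deg_f' [fx no_x] fy fz]].
  apply: (conj_tame (ord3_fun iy iz ix) f') => //; first exact: shaped3.
  (* The excluded configuration requires x^d with d > 1 in the first component, which here is free
     of x. *)
  apply: tame_cycle => // -[d [d1 _ [m mf mx] _ _]].
  by move: d1; rewrite -mx no_x.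
have ord3E (i : 'I_3) : [\/ i = ix, i = iy | i = iz].
  by move: i; apply: ord3P; [apply: Or31|apply: Or32|apply: Or33].
have := fs ix; have := fs iy; have := fs iz.
have xy : s ix <> s iy by move/s_inj.
have xz : s ix <> s iz by move/s_inj.
have yz : s iy <> s iz by move/s_inj.
(* Injectivity leaves six cases, with the triples (s ix, s iy, s iz) in lexicographic order. *)
case: (ord3E (s ix)) xy xz => ->; case: (ord3E (s iy)) yz => ->;
  case: (ord3E (s iz)) => -> // _ _ _ fz fy fx.
- by apply: stay; exists 1; apply: tame_id.
- by apply: stay; apply: tame_swap_yz.
- by apply: stay; apply: tame_swap_xy.
- have [[d [d1 dmax _ [m mf [mx _ _]] wd]]|not_bad] := pselect (exists d : nat, [/\ (1 < d)%N,
      forall m, m \in msupp (tnth f ix) -> (m ix <= d)%N,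
      exists2 m, m \in msupp (tnth f ix) & m ix = d,
      exists2 m, m \in msupp (tnth f iy) & [/\ m ix = (d * d)%N, m iy = 0%N & m iz = 0%N] &
      forall m, m \in msupp (tnth f iy) -> m iz = 0%N -> (m ix + m iy * d <= d * d)%N]);
    last by apply: stay; apply: tame_cycle.
  apply: to_cycle; apply: (@degenerate_cycle_conjugate _ f d) => //; first exact: ltnW.
  by exists m.
- by apply: to_cycle; apply: cycle_conjugate.
- have [dep|no_x] := pselect (exists2 m, m \in msupp (tnth f iy) & m ix != 0%N).
    by apply: stay; apply: tame_swap_xz.
  have [|f' [ff' deg_f' f'x f'y f'z]] := swap_xz_conjugate fx fy fz.
    by move=> m mf; apply/eqP/negPn/negP => mx; apply: no_x; exists m.
  apply: (conj_tame (ord3_fun ix iz iy) f') => //; first exact: shaped3.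
  exact: tame_swap_yz.
Qed.

Theorem proposition4 (R : realType) (k : fieldType) (f : endo k 3) :
  is_aut f -> affine_triangular f ->
  exists f' : endo k 3,
    [/\ is_aut f',
        aut_conjugate f f',
        permutation_triangular f',
        (endo_deg f' <= endo_deg f)%N &
        exists theta : R,
          [/\ is_maximal_eigenvalue f' theta,
              theta = 1%R \/
              (forall mu : 'rV[R]_3,
                 is_maximal_eigenvector f' theta mu ->
                 algebraically_stable mu f'),
              is_dynamical_degree f theta,
              is_dynamical_degree f' theta &
              is_handelman theta]].
Proof.
move=> f_aut f_at; have [s [g [sg fg deg_g]]] := affine_triangular_conjugate f_aut f_at.
have [s' [f' [sf' gf' deg_f' [th tame_f']]]] := tame_representative R sg.
have ff' := aut_conjugate_trans fg gf'.
exists f'; split=> //.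
- exact: aut_conjugate_aut ff' f_aut.
- exact: shaped_permutation_triangular sf'.
- exact: leq_trans deg_f' deg_g.
- by exists th; apply: tame_conclusion f_aut ff' sf' tame_f'.
Qed.
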